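(* Let $X$ be a computable Polish space, $\nu$ a computable Borel probability measure on $X$, and $(\mathscr F_n)$ an almost-full effective filtration equipped uniformly with Kurtz disintegrations $\rho^{(n)}$. Let $p>1$ be a computable real. Then for $x\in X$ the following are equivalent: (1) $x\in\mathsf{DR}^\nu_\rho(X)$; (2) $x\in\mathsf{KR}^\nu$ and $\lim_n\mathbb E_\nu[f\mid\mathscr F_n](x)=f(x)$ for all $L_p(\nu)$ Martin-Löf tests $f$; (3) $x\in\mathsf{KR}^\nu$, $\lim_n\mathbb E_\nu[f\mid\mathscr F_n](x)$ exists for all $L_p(\nu)$ Martin-Löf tests $f$, and $\lim_n\mathbb E_\nu[I_U\mid\mathscr F_n](x)=I_U(x)$ for every c.e. open $U$. Here ''$\lim_n a_n=b$'' means the limit exists, is finite and equals $b$; ''exists'' means exists and is finite.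
   Context: A computable Polish space is a Polish space $X$ with a distinguished dense sequence $x_0,x_1,\dots$ and a compatible complete metric $d$ with $d(x_i,x_j)$ uniformly computable. An open set is c.e. open if it equals $\bigcup_i B(x_{n(i)},r_i)$ for computable $n(\cdot)$ and a computable sequence of positive rationals $r_i$. A function $f:X\to(-\infty,\infty]$ is lower semi-computable (lsc) if the sets $f^{-1}(q,\infty]$, $q\in\mathbb Q$, are uniformly c.e. open. A Borel probability measure $\nu$ is computable if $\nu(U)$ is left-c.e. uniformly in the c.e. open $U$. For computable $p\ge1$, an $L_p(\nu)$ Martin-Löf test is an lsc $f:X\to[0,\infty]$ with $\|f\|_p<\infty$. $\mathsf{KR}^\nu$ is the set of points in every c.e. open set of $\nu$-measure 1; $\mathsf{MLR}^\nu$ the set of $x$ with $f(x)<\infty$ for every $L_1(\nu)$ Martin-Löf test $f$. A $\nu$-computable basis is a computable sequence of c.e. open sets such that every c.e. open set is effectively a union of its members, finite unions of members have uniformly computable $\nu$-measure, and each member is uniformly paired with an effectively closed superset of equal $\nu$-measure. An almost-full effective filtration is an increasing sequence $(\mathscr F_n)$ of $\sigma$-algebras, $\mathscr F_n$ generated by a sequence $\{A_{n,m}\}_m$, uniformly computable in $n,m$, of members of the algebra generated by a $\nu$-computable basis, with a uniform procedure computing from a c.e. open $U$ a sequence $A_{n_i,m_i}$ with $U\cap\mathsf{KR}^\nu=\bigcup_iA_{n_i,m_i}\cap\mathsf{KR}^\nu$. For countably generated $\mathscr F$, $[x]_{\mathscr F}$ is the set of points in exactly the same members of $\mathscr F$ as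 $x$. A Borel measurable $\rho:X\to\mathcal M^+(X)$ (finite nonnegative Borel measures) is a Kurtz disintegration of $\mathscr F$ with respect to $\nu$ if: (a) for every Borel $f$ with $\int|f|d\nu<\infty$, $x\mapsto\int f\,d\rho_x$ is a version of the conditional expectation of $f$ given $\mathscr F$; (b) for $x\in\mathsf{KR}^\nu$, $\rho_x(X)=1$ and $\rho_x([x]_{\mathscr F}\cap\mathsf{KR}^\nu)=1$; (c) $x\mapsto\rho_x(U)$ is lsc uniformly in c.e. open $U$. The filtration is equipped uniformly with such $\rho^{(n)}$ for $\mathscr F_n$, and $\mathbb E_\nu[f\mid\mathscr F_n](x)=\int f\,d\rho^{(n)}_x$. $\mathsf{DR}^\nu_\rho(X)$ (density random points) is the set of $x\in\mathsf{MLR}^\nu$ such that $\lim_n\rho^{(n)}_x(U)=\delta_x(U)$ for every c.e. open $U$, where $\delta_x$ is the Dirac measure at $x$. *)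

(* Defs.v *)
From Stdlib Require Cantor.
From HB Require Import structures.
From mathcomp Require Import all_boot all_order all_algebra.
From mathcomp Require Import all_classical all_reals all_analysis.
From mathcomp Require Import measurable_realfun.

Set Implicit Arguments.
Unset Strict Implicit.
Unset Printing Implicit Defensive.

Import Order.TTheory GRing.Theory Num.Theory.
Import numFieldNormedType.Exports.

Local Open Scope classical_set_scope.
Local Open Scope ring_scope.

Definition npair (a b : nat) : nat := Cantor.to_nat (a, b).
Definition nfst (n : nat) : nat := (Cantor.of_nat n).1.
Definition nsnd (n : nat) : nat := (Cantor.of_nat n).2.

(** Programs for the unary partial recursive functions; several arguments are
    passed through [npair]. *)
Inductive code : Type :=
| Zero
| Succ
| Fst
| Snd
| Pair of code & code
| Comp of code & code
| Prec of code & code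
| Mini of code.

(** [evals c n m]: the program [c] halts on input [n] with output [m].
    [Prec f g] maps <a, 0> to f(a) and <a, k+1> to g<a, <k, r>>, where r is its
    value at <a, k>; [Mini f] maps a to the least m with f<a, m> = 0, all
    previous values of f being defined. *)
Fixpoint evals (c : code) : nat -> nat -> Prop :=
  match c with
  | Zero => fun _ m => m = 0%N
  | Succ => fun n m => m = n.+1
  | Fst => fun n m => m = nfst n
  | Snd => fun n m => m = nsnd n
  | Pair f g => fun n m =>
      exists a b, [/\ evals f n a, evals g n b & m = npair a b]
  | Comp f g => fun n m => exists2 a, evals g n a & evals f a m
  | Prec f g => fun n =>
      (fix loop k m := match k with
       | 0%N => evals f (nfst n) m
       | k'.+1 => exists2 r, loop k' r &
                    evals g (npair (nfst n) (npair k' r)) m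
       end) (nsnd n)
  | Mini f => fun n m =>
      evals f (npair n m) 0%N /\
      forall i, (i < m)%N -> exists r, evals f (npair n i) r.+1
  end.

Fixpoint code_num (c : code) : nat :=
  match c with
  | Zero => npair 0 0
  | Succ => npair 1 0
  | Fst => npair 2 0
  | Snd => npair 3 0
  | Pair f g => npair 4 (npair (code_num f) (code_num g))
  | Comp f g => npair 5 (npair (code_num f) (code_num g))
  | Prec f g => npair 6 (npair (code_num f) (code_num g))
  | Mini f => npair 7 (code_num f)
  end.

Definition computable (h : nat -> nat) : Prop :=
  exists c, forall n, evals c n (h n).

Definition halting (c : code) : set nat := [set n | exists m, evals c n m].

Definition ce (A : set nat) : Prop := exists c, A = halting c.

(** The c.e. set of index [e]; it is empty when [e] is not the number of a
    program. *)
Definition ce_set (e : nat) : set nat :=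
  [set n | exists2 c, code_num c = e & halting c n].

Definition slice (A : set nat) (i : nat) : set nat := [set k | A (npair i k)].

Definition rat_num (k : nat) : rat :=
  ((nfst (nfst k))%:Q - (nsnd (nfst k))%:Q) / (nsnd k).+1%:Q.
Definition posrat_num (k : nat) : rat := (nfst k).+1%:Q / (nsnd k).+1%:Q.

Definition computable_real {R : realType} (a : R) : Prop :=
  exists2 h, computable h &
    forall k, `|a - ratr (rat_num (h k))| <= 2%:R ^- k.

Definition unif_computable_real {R : realType} (a : nat -> R) : Prop :=
  exists2 h, computable h &
    forall i k, `|a i - ratr (rat_num (h (npair i k)))| <= 2%:R ^- k.

Inductive alg_term : Type :=
| Gen of nat
| Compl of alg_term
| Union of alg_term & alg_term.

Fixpoint alg_num (t : alg_term) : nat :=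
  match t with
  | Gen i => npair 0 i
  | Compl t1 => npair 1 (alg_num t1)
  | Union t1 t2 => npair 2 (npair (alg_num t1) (alg_num t2))
  end.

Fixpoint alg_set {X : Type} (V : nat -> set X) (t : alg_term) : set X :=
  match t with
  | Gen i => V i
  | Compl t1 => ~` alg_set V t1
  | Union t1 t2 => alg_set V t1 `|` alg_set V t2
  end.

#[short(type="completeMetricType")]
HB.structure Definition CompleteMetric (R : realType) :=
  { X of Metric R X & Complete X & Pointed X }.

Definition computable_polish {R : realType} {X : completeMetricType R}
    (s : nat -> X) : Prop :=
  dense (range s) /\
  unif_computable_real (fun k => mdist (s (nfst k)) (s (nsnd k)) : R).

Definition borel {R : realType} (X : completeMetricType R) :
    measurableType (@open X).-sigma :=
  g_sigma_algebraType (@open X).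

Section randomness.
Context {R : realType} {X : completeMetricType R}.
Variable s : nat -> X.

Definition basic_ball (k : nat) : set X :=
  ball (s (nfst k)) (ratr (posrat_num (nsnd k)) : R).

Definition open_of (A : set nat) : set X := \bigcup_(k in A) basic_ball k.

(** The c.e. open set of index [e]. A nonempty c.e. set being the range of a
    total computable function, these are the unions of computable sequences of
    basic balls, together with the empty set. *)
Definition ce_open (e : nat) : set X := open_of (ce_set e).

Definition unif_ce_open (U : nat -> set X) : Prop :=
  exists2 A, ce A & forall i, U i = open_of (slice A i).

Definition lower_semicomputable (f : X -> \bar R) : Prop :=
  (forall x, -oo < f x)%E /\
  unif_ce_open (fun q => [set x | (ratr (rat_num q))%:E < f x]%E).

Definition unif_lower_semicomputable (f : nat -> X -> \bar R) : Prop :=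
  (forall i x, -oo < f i x)%E /\
  unif_ce_open
    (fun k => [set x | (ratr (rat_num (nsnd k)))%:E < f (nfst k) x]%E).

Variable nu : probability (borel X) R.

(** [nu (ce_open e)] is left-c.e. uniformly in [e]. *)
Definition computable_measure : Prop :=
  ce [set k | (ratr (rat_num (nsnd k)))%:E < nu (ce_open (nfst k))]%E.

Definition ML_test (p : R) (f : X -> \bar R) : Prop :=
  [/\ lower_semicomputable f,
      (forall x, 0 <= f x)%E &
      (Lnorm nu p%:E (f : borel X -> \bar R) < +oo)%E].

Definition KR : set X :=
  [set x | forall e, nu (ce_open e) = 1%E -> ce_open e x].

Definition MLR : set X := [set x | forall f, ML_test 1 f -> (f x < +oo)%E].

Definition computable_basis (V : nat -> set X) : Prop :=
  [/\ unif_ce_open V,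
      exists2 A, ce A & forall e, ce_open e = \bigcup_(i in slice A e) V i,
      unif_computable_real (fun l =>
        fine (nu (\bigcup_(i in [set i | i \in CodeSeq.decode l]) V i))) &
      exists2 W, unif_ce_open W &
        forall i, V i `<=` ~` W i /\ nu (~` W i) = nu (V i)].

Definition unif_computable_in_algebra (V : nat -> set X)
    (A : nat -> nat -> set X) : Prop :=
  exists2 t : nat -> nat -> alg_term,
    computable (fun k => alg_num (t (nfst k) (nsnd k))) &
    forall n m, A n m = alg_set V (t n m).

Definition almost_full_filtration (F : nat -> set (set X)) : Prop :=
  (forall n, F n `<=` F n.+1) /\
  exists A : nat -> nat -> set X,
  [/\ forall n, F n = <<s range (A n) >>,
      exists2 V, computable_basis V & unif_computable_in_algebra V A &
      exists2 S, ce S & forall e,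
        ce_open e `&` KR =
        (\bigcup_(k in slice S e) A (nfst k) (nsnd k)) `&` KR].

Definition atom (F : set (set X)) (x : X) : set X :=
  [set y | forall A, F A -> (A x <-> A y)].

Definition cond_exp_version (F : set (set X)) (f g : X -> \bar R) : Prop :=
  [/\ measurable_fun setT (g : g_sigma_algebraType F -> \bar R),
      nu.-integrable [set: borel X] g &
      forall A, F A ->
        (\int[nu]_(y in (A : set (borel X))) g y =
         \int[nu]_(y in (A : set (borel X))) f y)%E].

Definition cond_exp (rho : R.-ftker (borel X) ~> (borel X))
    (f : X -> \bar R) (x : X) : \bar R :=
  (\int[rho x]_y f y)%E.

(** Kurtz disintegrations [rho n] of [F n], uniformly in [n]. A Borel map into
    the finite Borel measures is a finite transition kernel. *)
Definition kurtz_disintegrations (F : nat -> set (set X))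
    (rho : nat -> R.-ftker (borel X) ~> (borel X)) : Prop :=
  [/\ forall n f, nu.-integrable [set: borel X] f ->
        cond_exp_version (F n) f (cond_exp (rho n) f),
      forall n x, KR x ->
        rho n x setT = 1%E /\ rho n x (atom (F n) x `&` KR) = 1%E &
      unif_lower_semicomputable
        (fun k x => rho (nfst k) x (ce_open (nsnd k)))].

Definition DR (rho : nat -> R.-ftker (borel X) ~> (borel X)) : set X :=
  [set x | MLR x /\ forall e,
     rho n x (ce_open e) @[n --> \oo] --> \d_(x : borel X) (ce_open e)].

End randomness.

(* Main.v *)
Require Import Defs.
From Stdlib Require Cantor.
From mathcomp Require Import all_boot all_order all_algebra.
From mathcomp Require Import all_classical all_reals all_analysis.
From mathcomp Require Import measurable_realfun ring lra zify.
Import Order.TTheory GRing.Theory Num.Theory.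
Import numFieldNormedType.Exports.

Set Implicit Arguments.
Unset Strict Implicit.
Unset Printing Implicit Defensive.

Local Open Scope classical_set_scope.
Local Open Scope ring_scope.

(** A Martin-Löf test, being a uniformly c.e. sequence of open sets [G k] with
    [nu (G k) = O(4^-k)], is turned into an L_1 test by counting:
    [y |-> sup {k + 1 | G k y}]; this is even an L_p test when
    [nu (G k) = O(4^-(P k))] with [p <= P].

    From (1) to (2), choose [b] with [p >= 1 + 2/b] and let
    [V i = {f > 2^(b i)}].  By Markov's inequality [nu (V i) = O(2^-((b+2) i))],
    and Doob's maximal inequality for the martingales [rho n (V i)] shows that
    the c.e. open sets
    [G k = U_(n,i) {y | rho n y (V i) > 4^k 2^-((b+1) i)}] form a Martin-Löf
    test.  If [x] is Martin-Löf random it leaves some [G k], which bounds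
    [rho n x (V i)] by a summable sequence with ratio below [2^-b], uniformly
    in [n]: the function [f] is uniformly integrable for the measures
    [rho n x], and convergence on c.e. open sets upgrades to convergence of the
    integrals.

    From (3) to (1), a test with infinite value at [x] would have conditional
    expectations at [x] exceeding every bound, since each superlevel set is a
    c.e. open set containing [x]. *)

(** * Computable functions and c.e. sets *)

Section computability.
Local Open Scope nat_scope.

Lemma nfst_pair a b : nfst (npair a b) = a.
Proof. by rewrite /nfst /npair Cantor.cancel_of_to. Qed.

Lemma nsnd_pair a b : nsnd (npair a b) = b.
Proof. by rewrite /nsnd /npair Cantor.cancel_of_to. Qed.

Lemma npair_fst_snd n : npair (nfst n) (nsnd n) = n.
Proof. by rewrite /nfst /nsnd /npair -surjective_pairing Cantor.cancel_to_of. Qed.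

Lemma npair_inj a b c d : npair a b = npair c d -> a = c /\ b = d.
Proof.
move=> e; split; first by rewrite -(nfst_pair a b) e nfst_pair.
by rewrite -(nsnd_pair a b) e nsnd_pair.
Qed.

Definition npairE := (nfst_pair, nsnd_pair).

Lemma eq_computable f g : f =1 g -> computable f -> computable g.
Proof. by move=> /funext ->. Qed.

Lemma computable_comp f g :
  computable f -> computable g -> computable (fun n => f (g n)).
Proof.
by move=> [c hc] [d hd]; exists (Comp c d) => n /=; exists (g n).
Qed.

Lemma computable_pair f g :
  computable f -> computable g -> computable (fun n => npair (f n) (g n)).
Proof.
by move=> [c hc] [d hd]; exists (Pair c d) => n /=; exists (f n), (g n).
Qed.

(** * Closure properties of total computable functions *)

Lemma computable_id : computable (fun n => n).
Proof.
by exists (Pair Fst Snd) => n /=; exists (nfst n), (nsnd n); rewrite npair_fst_snd.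
Qed.

Lemma computable_fst f : computable f -> computable (fun n => nfst (f n)).
Proof. by apply: computable_comp; exists Fst. Qed.

Lemma computable_snd f : computable f -> computable (fun n => nsnd (f n)).
Proof. by apply: computable_comp; exists Snd. Qed.

Lemma computable_succ f : computable f -> computable (fun n => (f n).+1).
Proof. by apply: computable_comp; exists Succ. Qed.

Fixpoint const_code k := if k is k'.+1 then Comp Succ (const_code k') else Zero.

Lemma evals_const_code k n m : evals (const_code k) n m <-> m = k.
Proof.
elim: k m => [//|k IH] m /=; split; first by case=> a /IH -> ->.
by move=> ->; exists k => //; apply/IH.
Qed.

Lemma computable_const k : computable (fun=> k).
Proof. by exists (const_code k) => n; apply/evals_const_code. Qed.

(** [Prec] passes the parameter, the counter and the previous value as one nested pair, which is why
    [g] is required to be computable in that packing. [Pair Fst Snd] is a program for the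
    identity. *)
Lemma computable_rec (f h : nat -> nat) (g : nat -> nat -> nat -> nat) :
  computable f ->
  computable (fun k => g (nfst k) (nfst (nsnd k)) (nsnd (nsnd k))) ->
  computable h ->
  computable (fun n => nat_rect (fun=> nat) (f n) (g n) (h n)).
Proof.
move=> [cf hf] [cg hg] [ch hh].
exists (Comp (Prec cf cg) (Pair (Pair Fst Snd) ch)) => n /=.
exists (npair n (h n)).
  exists n, (h n); split=> //.
  by exists (nfst n), (nsnd n); rewrite npair_fst_snd.
rewrite !npairE; elim: (h n) => [|k IH] //=.
eexists; first exact: IH.
by have := hg (npair n (npair k (nat_rect (fun=> nat) (f n) (g n) k)));
   rewrite !npairE.
Qed.

Lemma computable_add f g :
  computable f -> computable g -> computable (fun n => f n + g n).
Proof.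
move=> cf cg; pose st (n k r : nat) := r.+1.
apply: (@eq_computable (fun n => nat_rect (fun=> nat) (f n) (st n) (g n))).
  by move=> n; elim: (g n) => [|k /= ->]; rewrite ?addn0 ?addnS.
apply: computable_rec => //.
exact/computable_succ/computable_snd/computable_snd/computable_id.
Qed.

Lemma computable_mul f g :
  computable f -> computable g -> computable (fun n => f n * g n).
Proof.
move=> cf cg; pose st (n k r : nat) := f n + r.
apply: (@eq_computable (fun n => nat_rect (fun=> nat) 0 (st n) (g n))).
  by move=> n; elim: (g n) => [|k /= ->]; rewrite ?muln0 ?mulnS.
apply: computable_rec => //; first exact: computable_const.
apply: computable_add; first exact: computable_comp (computable_fst computable_id).
by do 2!apply: computable_snd; exact: computable_id.
Qed.

Lemma computable_pred f : computable f -> computable (fun n => (f n).-1).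
Proof.
move=> cf; pose st (n k r : nat) := k.
apply: (@eq_computable (fun n => nat_rect (fun=> nat) 0 (st n) (f n))).
  by move=> n; case: (f n).
apply: computable_rec => //; first exact: computable_const.
exact/computable_fst/computable_snd/computable_id.
Qed.

Lemma computable_sub f g :
  computable f -> computable g -> computable (fun n => f n - g n).
Proof.
move=> cf cg; pose st (n k r : nat) := r.-1.
apply: (@eq_computable (fun n => nat_rect (fun=> nat) (f n) (st n) (g n))).
  by move=> n; elim: (g n) => [|k /= ->]; rewrite ?subn0 ?subnS.
apply: computable_rec => //.
exact/computable_pred/computable_snd/computable_snd/computable_id.
Qed.

Lemma computable_exp f g :
  computable f -> computable g -> computable (fun n => f n ^ g n).
Proof.
move=> cf cg; pose st (n k r : nat) := f n * r.
apply: (@eq_computable (fun n => nat_rect (fun=> nat) 1 (st n) (g n))).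
  by move=> n; elim: (g n) => [|k /= ->]; rewrite ?expn0 ?expnS.
apply: computable_rec => //; first exact: computable_const.
apply: computable_mul; first exact: computable_comp (computable_fst computable_id).
exact/computable_snd/computable_snd/computable_id.
Qed.

(** * Decidable predicates *)

Definition decidable_pred (P : nat -> bool) := computable (fun n => P n : nat).

Lemma decidable_neg P : decidable_pred P -> decidable_pred (fun n => ~~ P n).
Proof.
move=> dP; apply: (@eq_computable (fun n => 1 - P n)).
  by move=> n; case: (P n).
by apply: computable_sub => //; exact: computable_const.
Qed.

Lemma decidable_and P Q : decidable_pred P -> decidable_pred Q ->
  decidable_pred (fun n => P n && Q n).
Proof.
move=> dP dQ; apply: (@eq_computable (fun n => P n * Q n)).
  by move=> n; rewrite mulnb.
exact: computable_mul.
Qed.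

Lemma decidable_or P Q : decidable_pred P -> decidable_pred Q ->
  decidable_pred (fun n => P n || Q n).
Proof.
move=> dP dQ; rewrite /decidable_pred.
under eq_fun do rewrite -[_ || _]negbK negb_or.
by apply/decidable_neg/decidable_and; exact: decidable_neg.
Qed.

Lemma decidable_leq f g : computable f -> computable g ->
  decidable_pred (fun n => f n <= g n).
Proof.
move=> cf cg; apply: (@eq_computable (fun n => 1 - (f n - g n))).
  by move=> n; rewrite /leq; case: (f n - g n).
by apply: computable_sub; [exact: computable_const|exact: computable_sub].
Qed.

Lemma decidable_eqn f g : computable f -> computable g ->
  decidable_pred (fun n => f n == g n).
Proof.
move=> cf cg; rewrite /decidable_pred; under eq_fun do rewrite eqn_leq.
by apply: decidable_and; exact: decidable_leq.
Qed.

Lemma decidable_all f (P : nat -> nat -> bool) : computable f ->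
  decidable_pred (fun k => P (nfst k) (nsnd k)) ->
  decidable_pred (fun n => all (P n) (iota 0 (f n))).
Proof.
move=> cf dP; pose st (n k r : nat) := r * P n k.
apply: (@eq_computable (fun n => nat_rect (fun=> nat) 1 (st n) (f n))).
  move=> n; elim: (f n) => [//|k IH].
  by rewrite -[in RHS]addn1 iotaD all_cat /= andbT add0n -mulnb IH.
apply: computable_rec => //; first exact: computable_const.
apply: computable_mul; first exact/computable_snd/computable_snd/computable_id.
apply: (@eq_computable (fun k => let m := npair (nfst k) (nfst (nsnd k)) in
    P (nfst m) (nsnd m))).
  by move=> k /=; rewrite !npairE.
apply: (computable_comp dP).
apply: computable_pair; first exact/computable_fst/computable_id.
exact/computable_fst/computable_snd/computable_id.
Qed.

Lemma decidable_comp P f : decidable_pred P -> computable f ->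
  decidable_pred (fun n => P (f n)).
Proof. by move=> dP cf; exact: (computable_comp dP cf). Qed.

(** The projection form of c.e. sets. Closure properties are proved in this form and carried over to
    halting domains by [ce_sigma1]. *)
Definition sigma1 (A : set nat) : Prop := exists2 h : nat -> bool,
  decidable_pred h & forall n, A n <-> exists w, h (npair n w).

Lemma eq_sigma1 A B : (forall n, A n <-> B n) -> sigma1 A -> sigma1 B.
Proof. by move=> AB [h hd hA]; exists h => // n; rewrite -AB. Qed.

Lemma sigma1_dec P : decidable_pred P -> sigma1 [set n | P n].
Proof.
move=> dP; exists (fun k => P (nfst k)).
  exact: decidable_comp dP (computable_fst computable_id).
move=> n; split=> /= [Pn|[w]]; last by rewrite npairE.
by exists 0; rewrite npairE.
Qed.

Lemma sigma1_comp A f : sigma1 A -> computable f -> sigma1 [set n | A (f n)].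
Proof.
move=> [h hd hA] cf; exists (fun k => h (npair (f (nfst k)) (nsnd k))).
  apply: decidable_comp => //; apply: computable_pair.
    exact: computable_comp cf (computable_fst computable_id).
  exact/computable_snd/computable_id.
by move=> n /=; rewrite hA; split=> -[w hw]; exists w; rewrite ?npairE in hw *.
Qed.

Lemma sigma1_ex (P : nat -> nat -> Prop) :
  sigma1 [set k | P (nfst k) (nsnd k)] -> sigma1 [set n | exists m, P n m].
Proof.
move=> [h hd hA].
exists (fun k => h (npair (npair (nfst k) (nfst (nsnd k))) (nsnd (nsnd k)))).
  apply: decidable_comp => //; apply: computable_pair.
    apply: computable_pair; first exact/computable_fst/computable_id.
    exact/computable_fst/computable_snd/computable_id.
  exact/computable_snd/computable_snd/computable_id.
move=> n /=; split.
  case=> m Pm; have [|w hw] := (hA (npair n m)).1; first by rewrite /= !npairE.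
  by exists (npair m w); rewrite !npairE.
case=> w; rewrite !npairE => hw.
have [_] := hA (npair n (nfst w)); rewrite /= !npairE => hP.
by exists (nfst w); apply: hP; exists (nsnd w).
Qed.

Lemma sigma1_and A B : sigma1 A -> sigma1 B -> sigma1 [set n | A n /\ B n].
Proof.
move=> [g dg gA] [h dh hB].
apply: (@eq_sigma1 [set n | exists w, g (npair n (nfst w)) && h (npair n (nsnd w))]).
  move=> n /=; rewrite gA hB; split.
    by case=> w /andP[h1 h2]; split; [exists (nfst w)|exists (nsnd w)].
  by case=> -[w h1] [v h2]; exists (npair w v); rewrite !npairE h1 h2.
apply: sigma1_ex; apply: sigma1_dec; apply: decidable_and;
  apply: decidable_comp => //; apply: computable_pair;
  try exact/computable_fst/computable_id.
  exact/computable_fst/computable_snd/computable_id.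
exact/computable_snd/computable_snd/computable_id.
Qed.

Lemma sigma1_or A B : sigma1 A -> sigma1 B -> sigma1 [set n | A n \/ B n].
Proof.
move=> [g dg gA] [h dh hB].
exists (fun k => g k || h k); first exact: decidable_or.
move=> n /=; rewrite gA hB; split.
  by case=> -[w hw]; exists w; rewrite hw ?orbT.
by case=> w /orP[] hw; [left|right]; exists w.
Qed.

(** Every number is read as an infinite sequence by iterating [nsnd], so no length has to be stored
    or checked. *)
Definition list_get (W i : nat) : nat :=
  nfst (nat_rect (fun=> nat) W (fun _ r => nsnd r) i).

Lemma list_get0 a W : list_get (npair a W) 0 = a.
Proof. by rewrite /list_get /= npairE. Qed.

Lemma list_getS a W i : list_get (npair a W) i.+1 = list_get W i.
Proof.
rewrite /list_get; congr nfst.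
by elim: i => [|i /= <-] //=; rewrite npairE.
Qed.

(** Finite choice, with all the witnesses packed in one number: this lets a bounded universal
    quantifier pass inside an existential one. *)
Lemma list_get_choice (P : nat -> nat -> Prop) m :
  (forall i, i < m -> exists w, P i w) ->
  exists W, forall i, i < m -> P i (list_get W i).
Proof.
elim: m P => [|m IH] P hP; first by exists 0.
have [//|w0 h0] := hP 0.
have [i im|W hW] := IH (fun i w => P i.+1 w); first exact: hP.
by exists (npair w0 W) => -[|i] im; rewrite ?list_get0 // list_getS; exact: hW.
Qed.

Lemma computable_list_get f g : computable f -> computable g ->
  computable (fun n => list_get (f n) (g n)).
Proof.
move=> cf cg; apply: computable_fst.
apply: (@computable_rec _ _ (fun _ _ r => nsnd r)) => //.
exact/computable_snd/computable_snd/computable_snd/computable_id.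
Qed.

(** One number [W] collects the witnesses for all [i < f n], and checking all of them is
    decidable. *)
Lemma sigma1_all f (P : nat -> nat -> Prop) : computable f ->
  sigma1 [set k | P (nfst k) (nsnd k)] ->
  sigma1 [set n | forall i, i < f n -> P n i].
Proof.
move=> cf [h dh hP].
pose Q n W i := h (npair (npair n i) (list_get W i)).
apply: (@eq_sigma1 [set n | exists W, all (Q n W) (iota 0 (f n))]).
  move=> n /=; split.
    case=> W /allP hW i ifn; have := (hP (npair n i)).2.
    rewrite /= !npairE; apply; exists (list_get W i).
    by apply: hW; rewrite mem_iota.
  move=> hn; have [i ifn|W hW] :=
      @list_get_choice (fun i w => h (npair (npair n i) w)) (f n).
    by have := (hP (npair n i)).1; rewrite /= !npairE; apply; exact: hn.
  by exists W; apply/allP => i; rewrite mem_iota; exact: hW.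
apply: sigma1_ex; apply: sigma1_dec.
apply: (@decidable_all (fun k => f (nfst k)) (fun k => Q (nfst k) (nsnd k))).
  exact: computable_comp cf (computable_fst computable_id).
apply: decidable_comp => //; apply: computable_pair.
  apply: computable_pair; first exact/computable_fst/computable_fst/computable_id.
  exact/computable_snd/computable_id.
apply: computable_list_get; first exact/computable_snd/computable_fst/computable_id.
exact/computable_snd/computable_id.
Qed.

End computability.

(** Computability by recursion on the syntax of the function. The last two cases treat a function
    variable applied to an argument, whose own computability is then found among the hypotheses. *)
Ltac computability_step :=
  lazymatch goal with
  | |- computable nfst => exact: (computable_fst computable_id)
  | |- computable nsnd => exact: (computable_snd computable_id)
  | |- computable S => exact: (computable_succ computable_id)
  | |- computable (fun n => n) => exact: computable_id
  | |- computable (fun _ => ?c) => exact: (computable_const c)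
  | |- computable (fun n => nfst _) => apply: computable_fst
  | |- computable (fun n => nsnd _) => apply: computable_snd
  | |- computable (fun n => npair _ _) => apply: computable_pair
  | |- computable (fun n => list_get _ _) => apply: computable_list_get
  | |- computable (fun n => S _) => apply: computable_succ
  | |- computable (fun n => predn _) => apply: computable_pred
  | |- computable (fun n => addn _ _) => apply: computable_add
  | |- computable (fun n => subn _ _) => apply: computable_sub
  | |- computable (fun n => muln _ _) => apply: computable_mul
  | |- computable (fun n => expn _ _) => apply: computable_exp
  | |- decidable_pred (fun n => _ && _) => apply: decidable_and
  | |- decidable_pred (fun n => _ || _) => apply: decidable_or
  | |- decidable_pred (fun n => ~~ _) => apply: decidable_neg
  | |- decidable_pred (fun n => leq _ _) => apply: decidable_leq
  | |- decidable_pred (fun n => eq_op _ _) => apply: decidable_eqn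
  | |- computable (fun n => ?h (@?g n)) =>
      is_var h; apply: (@computable_comp h g)
  | |- decidable_pred (fun n => ?h (@?g n)) =>
      is_var h; apply: (@decidable_comp h g)
  end.

Ltac computability := repeat first [assumption | computability_step].

(** * Halting domains, their closure properties and the s-m-n theorem *)

Section ce_sets.
Local Open Scope nat_scope.

(** By induction on the program: a primitive recursion is certified by its course of values, and a
    minimization by a bounded quantifier over the earlier values. *)
Lemma sigma1_evals c : sigma1 [set k | evals c (nfst k) (nsnd k)].
Proof.
elim: c => /= [||||f IHf g IHg|f IHf g IHg|f IHf g IHg|f IHf].
- apply: (@eq_sigma1 [set k | nsnd k == 0]); first by move=> n /=; split=> /eqP.
  by apply: sigma1_dec; computability.
- apply: (@eq_sigma1 [set k | nsnd k == (nfst k).+1]); first by move=> n /=; split=> /eqP.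
  by apply: sigma1_dec; computability.
- apply: (@eq_sigma1 [set k | nsnd k == nfst (nfst k)]); first by move=> n /=; split=> /eqP.
  by apply: sigma1_dec; computability.
- apply: (@eq_sigma1 [set k | nsnd k == nsnd (nfst k)]); first by move=> n /=; split=> /eqP.
  by apply: sigma1_dec; computability.
- apply: (@eq_sigma1 [set k | evals f (nfst k) (nfst (nsnd k)) /\
                              evals g (nfst k) (nsnd (nsnd k))]).
    move=> k /=; split; last by case=> a [b [? ? ->]]; rewrite !npairE.
    case=> hf hg; exists (nfst (nsnd k)), (nsnd (nsnd k)).
    by split=> //; rewrite npair_fst_snd.
  have cf : computable (fun k => npair (nfst k) (nfst (nsnd k))) by computability.
  have cg : computable (fun k => npair (nfst k) (nsnd (nsnd k))) by computability.
  apply: sigma1_and.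
    by apply: eq_sigma1 (sigma1_comp IHf cf) => k /=; rewrite !npairE.
  by apply: eq_sigma1 (sigma1_comp IHg cg) => k /=; rewrite !npairE.
- apply: (@eq_sigma1 [set k | exists a, evals g (nfst k) a /\ evals f a (nsnd k)]).
    by move=> k /=; split=> [[a [? ?]]|[a ? ?]]; exists a.
  have cg : computable (fun k => npair (nfst (nfst k)) (nsnd k)) by computability.
  have cf : computable (fun k => npair (nsnd k) (nsnd (nfst k))) by computability.
  apply: sigma1_ex; apply: sigma1_and.
    by apply: eq_sigma1 (sigma1_comp IHg cg) => k /=; rewrite !npairE.
  by apply: eq_sigma1 (sigma1_comp IHf cf) => k /=; rewrite !npairE.
(* [W] lists the values of the recursion at 0, ..., n, so the loop becomes a bounded conjunction of
   single steps. *)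
- apply: (@eq_sigma1 [set k | exists W, evals f (nfst (nfst k)) (list_get W 0) /\
     ((forall i, i < nsnd (nfst k) ->
       evals g (npair (nfst (nfst k)) (npair i (list_get W i))) (list_get W i.+1))
     /\ list_get W (nsnd (nfst k)) == nsnd k)]).
    move=> k /=; move: (nfst (nfst k)) (nsnd (nfst k)) (nsnd k) => a n m.
    split=> [[W [h0 [hS /eqP <-]]]|].
      elim: n hS => [//|n IHn] hS; exists (list_get W n).
        by apply: IHn => i im; apply: hS; exact: ltnW.
      exact: hS.
    pose run W n m := evals f a (list_get W 0) /\ ((forall i, i < n ->
       evals g (npair a (npair i (list_get W i))) (list_get W i.+1))
       /\ list_get W n = m).
    suff: forall n m, (fix loop k m := match k with
       | 0%N => evals f a m
       | k'.+1 => exists2 r, loop k' r & evals g (npair a (npair k' r)) m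
       end) n m -> exists W, run W n m.
      by move=> /[apply] -[W [? [? /eqP ?]]]; exists W.
    elim=> [|n' IHn] m'.
      by move=> hf; exists (npair m' 0); split; rewrite list_get0.
    case=> r /IHn[W [h0 [hS hr]]] hg.
    (* [W] codes an infinite sequence, so nothing can be appended to it. A new code is chosen that
       agrees with [W] up to [n'] and has [m'] at the next place. *)
    have [i _|W' hW'] := @list_get_choice
        (fun i w => w = if i <= n' then list_get W i else m') n'.+2.
      by eexists.
    exists W'; split; first by rewrite hW'.
    split; last by rewrite hW' // ltnn.
    move=> i; rewrite ltnS => ile; rewrite !hW' ?ltnS ?(leqW ile) //.
    rewrite ile; case: ltnP => [/hS//|nlei].
    by have -> : i = n'; [apply/eqP; rewrite eqn_leq ile|rewrite hr].
  apply: sigma1_ex; apply: sigma1_and.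
    have c1 : computable (fun k => npair (nfst (nfst (nfst k))) (list_get (nsnd k) 0))
      by computability.
    by apply: eq_sigma1 (sigma1_comp IHf c1) => k /=; rewrite !npairE.
  apply: sigma1_and.
    apply: (@sigma1_all (fun k => nsnd (nfst (nfst k))) (fun k i =>
        evals g (npair (nfst (nfst (nfst k))) (npair i (list_get (nsnd k) i)))
        (list_get (nsnd k) i.+1))); first by computability.
    have c1 : computable (fun l => npair
       (npair (nfst (nfst (nfst (nfst l))))
              (npair (nsnd l) (list_get (nsnd (nfst l)) (nsnd l))))
       (list_get (nsnd (nfst l)) (nsnd l).+1)) by computability.
    by apply: eq_sigma1 (sigma1_comp IHg c1) => k /=; rewrite !npairE.
  by apply: sigma1_dec; computability.
- apply: sigma1_and.
    have c1 : computable (fun k => npair k 0) by computability.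
    by apply: eq_sigma1 (sigma1_comp IHf c1) => k /=; rewrite !npairE npair_fst_snd.
  apply: (@sigma1_all (fun k => nsnd k)
    (fun k i => exists r, evals f (npair (nfst k) i) r.+1)); first by computability.
  apply: sigma1_ex.
  have c1 : computable (fun l => npair (npair (nfst (nfst (nfst l)))
      (nsnd (nfst l))) (nsnd l).+1) by computability.
  by apply: eq_sigma1 (sigma1_comp IHf c1) => k /=; rewrite !npairE.
Qed.

Lemma evals_functional c n a b : evals c n a -> evals c n b -> a = b.
Proof.
elim: c n a b => [||||f IHf g IHg|f IHf g IHg|f IHf g IHg|f IHf] n a b /=;
  try by move=> -> ->.
- move=> [a1 [a2 [fa ga ->]]] [b1 [b2 [fb gb ->]]].
  by rewrite (IHf _ _ _ fa fb) (IHg _ _ _ ga gb).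
- move=> [a1 ga fa] [b1 gb fb].
  by rewrite (IHg _ _ _ ga gb) in fa; exact: IHf fa fb.
- move: (nfst n) (nsnd n) => k m.
  elim: m a b => [|m IHm] a b; first exact: IHf.
  move=> [r1 l1 g1] [r2 l2 g2].
  by rewrite (IHm _ _ l1 l2) in g1; exact: IHg g1 g2.
- move=> [fa la] [fb lb]; case: (ltngtP a b) => // [/lb|/la] [r fr].
    by have := IHf _ _ _ fa fr.
  by have := IHf _ _ _ fb fr.
Qed.

(** From right to left, the program searches for a witness. [Mini] looks for a zero, hence the
    negation of [h]. *)
Lemma ce_sigma1 A : ce A <-> sigma1 A.
Proof.
split=> [[c ->]|[h [c hc] hA]].
  exact: (@sigma1_ex (evals c) (sigma1_evals c)).
have [d dE] : computable (fun k => ~~ h k : nat).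
  by apply: decidable_neg; exists c.
exists (Mini d); apply/seteqP; split=> [n /hA hn|n [m [dm _]]].
  have [w hw wmin] := ex_minnP hn.
  exists w; split; first by have := dE (npair n w); rewrite hw.
  move=> i iw; exists 0; have := dE (npair n i).
  by case: (boolP (h (npair n i))) => // /wmin; rewrite leqNgt iw.
apply/hA; exists m; have := evals_functional dm (dE _).
by case: (h _).
Qed.

Lemma eq_ce A B : (forall n, A n <-> B n) -> ce A -> ce B.
Proof. by move=> AB /ce_sigma1 sA; apply/ce_sigma1; exact: eq_sigma1 AB sA. Qed.

Lemma ce_dec P : decidable_pred P -> ce [set n | P n].
Proof. by move=> dP; apply/ce_sigma1/sigma1_dec. Qed.

Lemma ce_comp A f : ce A -> computable f -> ce [set n | A (f n)].
Proof. by move=> /ce_sigma1 sA cf; apply/ce_sigma1/sigma1_comp. Qed.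

Lemma ce_ex (P : nat -> nat -> Prop) :
  ce [set k | P (nfst k) (nsnd k)] -> ce [set n | exists m, P n m].
Proof. by move=> /ce_sigma1 sP; apply/ce_sigma1/sigma1_ex. Qed.

Lemma ce_and A B : ce A -> ce B -> ce [set n | A n /\ B n].
Proof. by move=> /ce_sigma1 sA /ce_sigma1 sB; apply/ce_sigma1/sigma1_and. Qed.

Lemma ce_or A B : ce A -> ce B -> ce [set n | A n \/ B n].
Proof. by move=> /ce_sigma1 sA /ce_sigma1 sB; apply/ce_sigma1/sigma1_or. Qed.

Lemma ce_all f (P : nat -> nat -> Prop) : computable f ->
  ce [set k | P (nfst k) (nsnd k)] ->
  ce [set n | forall i, i < f n -> P n i].
Proof. by move=> cf /ce_sigma1 sP; apply/ce_sigma1/sigma1_all. Qed.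

Lemma code_num_inj : injective code_num.
Proof.
elim=> [||||f IHf g IHg|f IHf g IHg|f IHf g IHg|f IHf]
  [||||f' g'|f' g'|f' g'|f'] // /npair_inj[] // _.
- by move=> /npair_inj[/IHf -> /IHg ->].
- by move=> /npair_inj[/IHf -> /IHg ->].
- by move=> /npair_inj[/IHf -> /IHg ->].
- by move=> /IHf ->.
Qed.

Lemma ce_set_code_num c : ce_set (code_num c) = halting c.
Proof.
apply/seteqP; split=> [n [d /code_num_inj ->]//|n hn].
by exists c.
Qed.

Lemma ce_ce_set e : ce (ce_set e).
Proof.
have [[c <-]|nc] := pselect (exists c, code_num c = e).
  by exists c; rewrite ce_set_code_num.
apply: (@eq_ce [set n | n.+1 <= n]); last by apply: ce_dec; computability.
by move=> n; rewrite /= ltnn; split=> // -[c ce _]; case: nc; exists c.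
Qed.

Lemma computable_num_const_code : computable (fun k => code_num (const_code k)).
Proof.
pose st (n k r : nat) := npair 5 (npair (npair 1 0) r).
apply: (@eq_computable (fun n => nat_rect (fun=> nat) (npair 0 0) (st n) n)).
  by elim=> //= n ->.
by apply: computable_rec; rewrite /st; computability.
Qed.

(** The s-m-n theorem: [i] is hard-wired through [const_code i], and the number of the composed
    program depends computably on [i]. *)
Lemma smn_ce_set B : ce B ->
  exists2 e, computable e & forall i, ce_set (e i) = slice B i.
Proof.
move=> [c ->].
exists (fun i => code_num (Comp c (Pair (const_code i) (Pair Fst Snd)))).
  have ? := computable_num_const_code.
  rewrite [fun i => _]/=; computability.
move=> i; rewrite ce_set_code_num; apply/seteqP; split=> n [m] /=.
  case=> a [a1 [a2 [/evals_const_code -> [b1 [b2 [-> -> ->]]] ->]]] hm.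
  by exists m; rewrite npair_fst_snd in hm.
move=> hm; exists m, (npair i n) => //; exists i, n; split=> //.
  exact/evals_const_code.
by exists (nfst n), (nsnd n); rewrite npair_fst_snd.
Qed.

End ce_sets.

(** * Rational codes and c.e. open sets *)

Section rational_codes.

(** Code of (a - b)/(c + 1) with respect to [rat_num]. *)
Definition rat_code (a b c : nat) : nat := npair (npair a b) c.

(** The inequality of fractions after cross-multiplication, with the subtracted terms moved across
    so that only natural numbers occur. *)
Definition rat_lt (k l : nat) : bool :=
  (nfst (nfst k) * (nsnd l).+1 + nsnd (nfst l) * (nsnd k).+1 <
   nfst (nfst l) * (nsnd k).+1 + nsnd (nfst k) * (nsnd l).+1)%N.

Definition rat_add (k l : nat) : nat :=
  rat_code (nfst (nfst k) * (nsnd l).+1 + nfst (nfst l) * (nsnd k).+1)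
           (nsnd (nfst k) * (nsnd l).+1 + nsnd (nfst l) * (nsnd k).+1)
           ((nsnd k).+1 * (nsnd l).+1).-1.

Lemma rat_num_code a b c :
  rat_num (rat_code a b c) = (a%:R - b%:R) / c.+1%:R.
Proof. by rewrite /rat_num !npairE. Qed.

Lemma rat_numE k : rat_num k =
  ((nfst (nfst k))%:R - (nsnd (nfst k))%:R) / (nsnd k).+1%:R.
Proof. by []. Qed.

Lemma rat_ltE k l : rat_lt k l = (rat_num k < rat_num l).
Proof.
rewrite !rat_numE ltr_pdivrMr ?ltr0n// mulrAC ltr_pdivlMr ?ltr0n//.
rewrite !mulrBl ltrBlDr addrAC ltrBrDr /rat_lt -!natrM -!natrD ltr_nat.
by [].
Qed.

Lemma rat_num_add k l : rat_num (rat_add k l) = rat_num k + rat_num l.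
Proof.
rewrite rat_num_code prednK ?muln_gt0// !rat_numE !natrD !natrM.
have : ((nsnd k).+1%:R : rat) != 0 by rewrite pnatr_eq0.
have : ((nsnd l).+1%:R : rat) != 0 by rewrite pnatr_eq0.
by move=> ? ?; field; apply/andP.
Qed.

Lemma rat_num_surj (r : rat) : exists k, rat_num k = r.
Proof.
have [d dE] : exists d : nat, denq r = d.+1%:Z.
  by have := denq_gt0 r; case: (denq r) => // -[|d] // _; exists d.
rewrite -[r]divq_num_den dE; case: (numq r) => n.
  by exists (rat_code n 0 d); rewrite rat_num_code subr0.
by exists (rat_code 0 n.+1 d); rewrite rat_num_code sub0r NegzE rmorphN.
Qed.

Lemma posrat_numE k :
  posrat_num k = rat_num (rat_code (nfst k).+1 0 (nsnd k)).
Proof. by rewrite rat_num_code subr0. Qed.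

Lemma posrat_num_gt0 k : 0 < posrat_num k.
Proof. by rewrite divr_gt0 ?ltr0z. Qed.

Lemma posrat_num_surj (r : rat) : 0 < r -> exists k, posrat_num k = r.
Proof.
have [d dE] : exists d : nat, denq r = d.+1%:Z.
  by have := denq_gt0 r; case: (denq r) => // -[|d] // _; exists d.
rewrite -numq_gt0; have := divq_num_den r; rewrite dE.
case: (numq r) => // -[|n] // <- _.
by exists (npair n d); rewrite /posrat_num !npairE.
Qed.

Lemma computable_rat_code f g h : computable f -> computable g ->
  computable h -> computable (fun n => rat_code (f n) (g n) (h n)).
Proof. by move=> cf cg ch; rewrite /rat_code; computability. Qed.

Lemma computable_rat_add f g : computable f -> computable g ->
  computable (fun n => rat_add (f n) (g n)).
Proof. by move=> cf cg; rewrite /rat_add /rat_code; computability. Qed.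

Lemma decidable_rat_lt f g : computable f -> computable g ->
  decidable_pred (fun n => rat_lt (f n) (g n)).
Proof. by move=> cf cg; rewrite /rat_lt; computability. Qed.

Variable R : realType.

Lemma rat_ltrE k l :
  rat_lt k l = (ratr (rat_num k) < ratr (rat_num l) :> R).
Proof. by rewrite ltr_rat rat_ltE. Qed.

Lemma ratr_code a b c :
  ratr (rat_num (rat_code a b c)) = (a%:R - b%:R) / c.+1%:R :> R.
Proof. by rewrite rat_num_code fmorph_div /= rmorphB /= !ratr_nat. Qed.

Lemma rat_num_between (a b : R) : a < b ->
  exists2 k, a < ratr (rat_num k) & ratr (rat_num k) < b.
Proof.
move=> /rat_in_itvoo[q]; have [k <-] := rat_num_surj q.
by rewrite in_itv /= => /andP[? ?]; exists k.
Qed.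

Lemma posrat_num_between (a b : R) : 0 <= a -> a < b ->
  exists2 k, a < ratr (posrat_num k) & ratr (posrat_num k) < b.
Proof.
move=> a0 /rat_in_itvoo[q]; rewrite in_itv /= => /andP[aq qb].
have /posrat_num_surj[k qE] : 0 < q by rewrite -(@ltr0q R) (le_lt_trans a0).
by exists k; rewrite qE.
Qed.

Lemma rat_num_betweene (a : R) (b : \bar R) : (a%:E < b)%E ->
  exists2 k, a < ratr (rat_num k) & ((ratr (rat_num k))%:E < b)%E.
Proof.
case: b => [b| |//]; first by rewrite lte_fin; exact: rat_num_between.
have [|k ak _ _] := @rat_num_between a (a + 1); first by rewrite ltrDl.
exists k => //.
exact: ltry.
Qed.

Lemma exists_expVn_lt (e : R) : 0 < e -> exists m, 2 ^- m < e.
Proof.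
move=> e0; exists (Num.bound e^-1); rewrite -ltf_pV2 ?posrE ?invr_gt0 ?exprn_gt0//.
rewrite invrK (lt_trans (archi_boundP _)) ?invr_ge0 ?ltW//.
by rewrite -natrX ltr_nat ltn_expl.
Qed.

(** A rational q is below the real exactly when q + 2^-m is below its approximation of precision
    2^-m for some m. The code [rat_code 1 0 (2 ^ m).-1] stands for 2^-m. *)
Lemma ce_lt_computable_real (a : nat -> R) : unif_computable_real a ->
  ce [set k | ratr (rat_num (nfst k)) < a (nsnd k)].
Proof.
move=> [h ch hE].
apply: (@eq_ce [set k | exists m,
   rat_lt (rat_add (nfst k) (rat_code 1 0 (2 ^ m).-1)) (h (npair (nsnd k) m))]);
  last first.
  apply: ce_ex; apply: ce_dec; apply: decidable_rat_lt; last by computability.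
  by apply: computable_rat_add; [|apply: computable_rat_code]; computability.
move=> k /=; have pow m : (2 ^ m).-1.+1%:R = 2 ^+ m :> R.
  by rewrite prednK ?expn_gt0// natrX.
split=> [[m]|qa].
  rewrite rat_ltrE rat_num_add rmorphD /= ratr_code subr0 pow mul1r.
  by have := hE (nsnd k) m; rewrite ler_norml => /andP[+ _]; lra.
have d0 : 0 < (a (nsnd k) - ratr (rat_num (nfst k))) / 2 by lra.
have [m hm] : exists m, 2 ^- m < (a (nsnd k) - ratr (rat_num (nfst k))) / 2.
  exact: exists_expVn_lt.
exists m; rewrite rat_ltrE rat_num_add rmorphD /= ratr_code subr0 pow mul1r.
by have := hE (nsnd k) m; rewrite ler_norml => /andP[_]; lra.
Qed.

End rational_codes.

(** * C.e. open sets and lower semi-computable functions *)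

Section open_sets.
Context {R : realType} {X : completeMetricType R}.
Variable s : nat -> X.

Lemma open_basic_ball k : open (basic_ball s k).
Proof.
rewrite openE /basic_ball => y; rewrite ballEmdist /= => yk.
apply/nbhs_ballP.
exists (ratr (posrat_num (nsnd k)) - mdist (s (nfst k)) y); first by rewrite /= subr_gt0.
move=> z; rewrite ballEmdist /= ltrBrDl; apply: le_lt_trans.
exact: metric_triangle.
Qed.

Lemma open_open_of A : open (open_of s A).
Proof. by apply: bigcup_open => k _; exact: open_basic_ball. Qed.

Lemma measurable_open_of A : measurable (open_of s A : set (borel X)).
Proof. by apply: sub_sigma_algebra; exact: open_open_of. Qed.

(** Density gives a centre within [e] of [y], and a rational radius fits between that distance and
    [e]. *)
Lemma basic_ball_near (y : X) (e : R) : dense (range s) -> 0 < e ->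
  exists2 k, basic_ball s k y &
    mdist (s (nfst k)) y < e /\ ratr (posrat_num (nsnd k)) < e.
Proof.
move=> ds e0.
have [z [yz [i _ iz]]] : (ball y e)° `&` range s !=set0.
  apply: ds; last exact: open_interior.
  by exists y; exact: nbhsx_ballx.
move: yz; rewrite -iz => /interior_subset; rewrite ballEmdist /= metric_sym => yi.
have [k dk ke] := posrat_num_between (mdist_ge0 (s i) y) yi.
by exists (npair i k); rewrite /basic_ball ?ballEmdist /= !npairE.
Qed.

Lemma open_ofT : dense (range s) -> open_of s setT = setT.
Proof.
move=> ds; apply/seteqP; split=> // y _.
by have [k yk _] := basic_ball_near y ds ltr01; exists k.
Qed.

(** By s-m-n, a uniform enumeration yields a computable sequence of indices. The effectivity of [nu]
    and of the kernels is stated in terms of such indices. *)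
Lemma unif_ce_openP (U : nat -> set X) :
  unif_ce_open s U -> exists2 e, computable e & forall i, U i = ce_open s (e i).
Proof.
move=> [A /smn_ce_set[e ce eA] UA]; exists e => // i.
by rewrite UA /ce_open eA.
Qed.

Lemma lower_semicomputable_gt f : lower_semicomputable s f ->
  exists2 e, computable e &
    forall q, [set x | (ratr (rat_num q))%:E < f x]%E = ce_open s (e q).
Proof. by move=> [_ /unif_ce_openP]. Qed.

Lemma measurable_lower_semicomputable f : lower_semicomputable s f ->
  measurable_fun setT (f : borel X -> \bar R).
Proof.
move=> /lower_semicomputable_gt[e _ fE].
apply: (measurability _ (ErealGenOInfty.measurableE R)).
move=> _ [_ [r ->] <-]; rewrite setTI.
rewrite (_ : _ @^-1` _ = \bigcup_(q in [set q | r <= ratr (rat_num q)])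
    (ce_open s (e q) : set (borel X))).
  by apply: bigcup_measurable => q _; exact: measurable_open_of.
rewrite preimage_itvoy; apply/seteqP; split=> y /=.
  move=> /rat_num_betweene[q rq qy]; exists q; first exact: ltW.
  by rewrite -fE.
by move=> [q rq]; rewrite -fE /=; apply: le_lt_trans; rewrite lee_fin.
Qed.

End open_sets.

(** * Martin-Löf tests from sequences of c.e. open sets *)

Section integrals.
Context {R : realType} {d : measure_display} {T : measurableType d}.
Variable mu : {measure set T -> \bar R}.
Local Open Scope ereal_scope.

Lemma nneseries_ge_term (u : nat -> \bar R) k :
  (forall n, 0 <= u n) -> u k <= \sum_(0 <= i <oo) u i.
Proof.
move=> u0; apply: le_trans (nneseries_lim_ge k.+1 (fun n _ _ => u0 n)).
rewrite big_nat_recr//=; apply: leeDr.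
by apply: sume_ge0 => i _; exact: u0.
Qed.

Lemma ge0_integral_indicZ (U : set T) (a : R) : measurable U -> (0 <= a)%R ->
  \int[mu]_y (a * \1_U y)%:E = a%:E * mu U.
Proof.
move=> mU a0; under eq_integral do rewrite EFinM.
rewrite ge0_integralZl ?integral_indic ?setIT//.
by apply/measurable_EFinP; exact: measurable_indic.
Qed.

(** Markov's inequality, with the set left as a parameter. *)
Lemma le_measure_gt_integral (f : T -> \bar R) (U : set T) (q : R) :
  (forall y, 0 <= f y) -> measurable_fun setT f -> measurable U ->
  (0 <= q)%R -> (forall y, U y -> q%:E <= f y) ->
  q%:E * mu U <= \int[mu]_y f y.
Proof.
move=> f0 mf mU q0 Uf; rewrite -ge0_integral_indicZ//.
apply: ge0_le_integral => //.
- by move=> y _; rewrite lee_fin mulr_ge0.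
- by apply/measurable_EFinP; exact: measurable_funM.
move=> y _; rewrite indicE; case: (boolP (y \in U)) => [|_].
  by rewrite inE mulr1; exact: Uf.
by rewrite mulr0.
Qed.

(** Serves to bound integrals from above by truncation: a constant part, a middle part of bounded
    height on [U], and a tail cut into the layers [V i]. *)
Lemma integral_indic_series_le (f : T -> \bar R) (q a : R) (w : nat -> R)
    (U : set T) (V : nat -> set T) :
  (forall y, 0 <= f y) -> measurable_fun setT f -> measurable U ->
  (forall i, measurable (V i)) -> (0 <= q)%R -> (0 <= a)%R ->
  (forall i, (0 <= w i)%R) ->
  (forall y, f y <= q%:E + (a * \1_U y)%:E +
                    \sum_(0 <= i <oo) (w i * \1_(V i) y)%:E) ->
  \int[mu]_y f y <=
    q%:E * mu setT + a%:E * mu U + \sum_(0 <= i <oo) ((w i)%:E * mu (V i)).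
Proof.
move=> f0 mf mU mV q0 a0 w0 fle.
have mZ (W : set T) (c : R) : measurable W ->
    measurable_fun setT (fun y => (c * \1_W y)%:E).
  by move=> mW; apply/measurable_EFinP; exact: measurable_funM.
have Z0 (W : set T) (c : R) y : (0 <= c)%R -> 0 <= (c * \1_W y)%:E.
  by move=> c0; rewrite lee_fin mulr_ge0.
have mS : measurable_fun setT
    (fun y => \sum_(0 <= i <oo) (w i * \1_(V i) y)%:E).
  by apply: ge0_emeasurable_sum => [k y _ _|k _]; [exact: Z0|exact: mZ].
have S0 y : 0 <= \sum_(0 <= i <oo) (w i * \1_(V i) y)%:E.
  by apply: nneseries_ge0 => k _ _; exact: Z0.
have mq : measurable_fun setT (fun y => q%:E + (a * \1_U y)%:E).
  by apply: emeasurable_funD => //; exact: mZ.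
apply: le_trans (ge0_le_integral mu measurableT _ mf _ (fun y _ => fle y)) _ => //.
  exact: emeasurable_funD.
rewrite ge0_integralD//; last by move=> y _; rewrite adde_ge0 ?lee_fin ?mulr_ge0.
rewrite ge0_integralD//; [|by move=> y _; exact: Z0|exact: mZ].
rewrite integral_cst// ge0_integral_indicZ//.
rewrite integral_nneseries//; [|by move=> i; exact: mZ|by move=> i y _; exact: Z0].
by under eq_eseriesr do rewrite ge0_integral_indicZ//.
Qed.

End integrals.

(** * Counting tests *)

Section counting_tests.
Context {R : realType} {X : completeMetricType R}.
Variables (s : nat -> X) (nu : probability (borel X) R).
Hypothesis s_dense : dense (range s).

(** Adjoining 0 keeps the supremum from being -oo at points in no [G k]. The weight [k.+1] makes a
    set occurring only at index 0 yield its indicator. *)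
Definition counting_test (G : nat -> set X) (y : X) : \bar R :=
  ereal_sup [set z | z = 0%E \/ exists2 k, G k y & z = k.+1%:R%:E].

Lemma counting_test_ge0 G y : (0 <= counting_test G y)%E.
Proof. by apply: ereal_sup_ubound; left. Qed.

Lemma counting_test_ge G y k : G k y -> (k.+1%:R%:E <= counting_test G y)%E.
Proof. by move=> Gky; apply: ereal_sup_ubound; right; exists k. Qed.

Lemma counting_test_gt G y (q : R) : (q%:E < counting_test G y)%E <->
  q < 0 \/ exists k, q < k.+1%:R /\ G k y.
Proof.
split=> [/ereal_sup_gt[_ [->|[k Gky ->]]]|[q0|[k [qk Gky]]]].
- by rewrite lte_fin; left.
- by rewrite lte_fin; right; exists k.
- by apply: lt_le_trans (counting_test_ge0 _ _); rewrite lte_fin.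
- by apply: lt_le_trans (counting_test_ge Gky); rewrite lte_fin.
Qed.

Lemma counting_test_pinfty G y :
  (forall k, G k y) -> counting_test G y = +oo%E.
Proof.
move=> Gy; apply/eqyP => r r0; apply: le_trans (counting_test_ge (Gy (Num.bound r))).
rewrite lee_fin ltW// (lt_trans (archi_boundP (ltW r0)))//.
by rewrite ltr_nat.
Qed.

Lemma lower_semicomputable_counting G :
  unif_ce_open s G -> lower_semicomputable s (counting_test G).
Proof.
move=> [A cA GA]; split.
  by move=> y; apply: lt_le_trans (counting_test_ge0 _ _); exact: ltNyr.
(* For a negative threshold all basic balls are enumerated, and they cover the space by density.
   Otherwise the balls come from those [G i] for which i + 1 exceeds the threshold. *)
exists [set k | rat_lt (nfst k) (rat_code 0 0 0) \/ exists i,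
    rat_lt (nfst k) (rat_code i.+1 0 0) /\ A (npair i (nsnd k))].
  apply: ce_or.
    apply: ce_dec; apply: decidable_rat_lt; first by computability.
    exact: computable_const.
  apply: ce_ex; apply: ce_and.
    apply: ce_dec; apply: decidable_rat_lt; first by computability.
    by apply: computable_rat_code; computability.
  by apply: ce_comp => //; computability.
move=> q; apply/seteqP; split=> y /=.
  rewrite counting_test_gt => -[q0|[i [qi]]].
    have : open_of s setT y by rewrite open_ofT.
    move=> [k _ yk]; exists k => //=; left.
    by rewrite !npairE (rat_ltrE R) ratr_code subrr mul0r.
  rewrite GA => -[k Aik yk]; exists k => //=; right; exists i.
  by rewrite !npairE (rat_ltrE R) ratr_code subr0 divr1.
move=> [k]; rewrite /slice /= !npairE (rat_ltrE R) ratr_code subrr mul0r.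
move=> h yk; rewrite counting_test_gt; case: h => [q0|[i [qi Aik]]]; [by left|right].
exists i; rewrite GA; split; last by exists k.
by move: qi; rewrite (rat_ltrE R) ratr_code subr0 divr1.
Qed.

Local Open Scope ereal_scope.

(** Each value k + 1 in the supremum has p-th power at most (k + 1)^P, which is a single term of the
    series. The comparison is made after taking p-th roots, so that it passes to the supremum. *)
Lemma counting_test_poweR_le G (p : R) (P : nat) y : (0 < p)%R -> (p <= P%:R)%R ->
  counting_test G y `^ p <= \sum_(0 <= k <oo) (k.+1%:R ^+ P * \1_(G k) y)%:E.
Proof.
move=> p0 pP; set S := \sum_(0 <= k <oo) _.
have t0 (k : nat) : 0 <= (k.+1%:R ^+ P * \1_(G k) y : R)%:E.
  by rewrite lee_fin mulr_ge0// exprn_ge0.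
have S0 : 0 <= S by apply: nneseries_ge0 => k _ _; exact: t0.
have in0y (z : \bar R) : 0 <= z -> z \in `[0, +oo].
  by move=> z0; rewrite in_itv /= z0 leey.
suff : counting_test G y <= S `^ p^-1.
  move=> h; have := gt0_ler_poweR (ltW p0) (in0y _ (counting_test_ge0 G y)) _ h.
  rewrite -poweRrM mulVf ?gt_eqF// poweRe1//; apply.
  by apply: in0y; exact: poweR_ge0.
apply: ge_ereal_sup => _ [->|[k Gky ->]]; first exact: poweR_ge0.
have -> : k.+1%:R%:E = (k.+1%:R `^ p)%:E `^ p^-1 :> \bar R.
  by rewrite -poweR_EFin -poweRrM mulfV ?gt_eqF// poweRe1.
apply: gt0_ler_poweR; [by rewrite invr_ge0 ltW| |exact: in0y|].
  by apply: in0y; rewrite lee_fin powR_ge0.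
apply: le_trans (nneseries_ge_term k t0).
rewrite lee_fin indicE mem_set// mulr1 -powR_mulrn// ler_powR//.
by rewrite ler1n.
Qed.

Lemma ML_test_counting G (C p : R) (P : nat) : unif_ce_open s G ->
  (0 < p)%R -> (p <= P%:R)%R ->
  (forall k, nu (G k : set (borel X)) <= (C * 4 ^- (P * k))%:E) ->
  ML_test s nu p (counting_test G).
Proof.
move=> uG p0 pP nuG; have lG := lower_semicomputable_counting uG.
have mG k : measurable (G k : set (borel X)).
  by case: uG => A _ ->; exact: measurable_open_of.
split=> //; first exact: counting_test_ge0.
rewrite unlock; apply: poweR_lty.
under eq_integral do rewrite gee0_abs ?counting_test_ge0//.
pose t (k : nat) (y : borel X) : \bar R := (k.+1%:R ^+ P)%:E * (\1_(G k) y)%:E.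
have t0 k y : 0 <= t k y by rewrite mule_ge0// lee_fin exprn_ge0.
have mt k : measurable_fun [set: borel X] (t k).
  apply: measurable_funeM; apply/measurable_EFinP; exact: measurable_indic.
apply: (@le_lt_trans _ _ (\int[nu]_y \sum_(0 <= k <oo) t k y)).
  apply: ge0_le_integral => //.
  - by move=> y _; exact: poweR_ge0.
  - apply: (measurableT_comp (measurable_poweR _)).
    exact: measurable_lower_semicomputable lG.
  - by apply: ge0_emeasurable_sum => // k y _ _; exact: t0.
  - move=> y _; apply: le_trans (counting_test_poweR_le _ _ p0 pP) _.
    by under eq_eseriesr do rewrite EFinM.
rewrite integral_nneseries//.
have P0 : (0 < P)%N by rewrite -(@ltr0n R) (lt_le_trans p0).
have C0 : (0 <= C)%R.
  have := le_trans (measure_ge0 nu _) (nuG 0%N).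
  by rewrite muln0 expr0 invr1 mulr1 lee_fin.
(* The k-th integral is at most C 2^-k = 2C / 2^(k+1), the form that [epsilon_trick0] sums. This
   needs (k + 1)^P 2^k <= 4^(P k), which follows from k < 2^k and P > 0. *)
apply: (@le_lt_trans _ _ (2 * C)%:E); last exact: ltry.
apply: le_trans (@epsilon_trick0 _ _ xpredT _); last by rewrite mulr_ge0.
apply: lee_nneseries => [k _ _|k _].
  by apply: integral_ge0 => y _; exact: t0.
rewrite /t ge0_integralZl//; last first.
  by apply/measurable_EFinP; exact: measurable_indic.
rewrite integral_indic// setIT.
apply: le_trans (lee_wpmul2l _ (nuG k)) _; first by rewrite lee_fin exprn_ge0.
rewrite -EFinM lee_fin mulrCA [(2 * C)%R]mulrC -mulrA ler_wpM2l//.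
rewrite natrX exprS invfM mulrA mulfV// mul1r.
rewrite ler_pdivrMr ?exprn_gt0// mulrC ler_pdivlMr ?exprn_gt0//.
rewrite -!natrX -natrM ler_nat.
apply: (@leq_trans ((k.+1 * 2 ^ k) ^ P)).
  rewrite expnMn leq_mul2l -expnM leq_exp2l//.
  by rewrite leq_pmulr ?orbT.
rewrite [(P * k)%N]mulnC expnM leq_exp2r// (_ : 4 = 2 * 2)%N// expnMn leq_mul2r.
by rewrite ltn_expl ?orbT.
Qed.

(** At a point of every [G k] the counting test is infinite, and it is an L_1 test by the case P =
    1. *)
Lemma MLR_not_in_all G (C : R) x : unif_ce_open s G ->
  (forall k, nu (G k : set (borel X)) <= (C * 4 ^- k)%:E) ->
  MLR s nu x -> exists k, ~ G k x.
Proof.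
move=> uG nuG xM; apply/existsNP => xG.
have := xM _ (@ML_test_counting G C 1 1 uG ltr01 (lexx _) _).
rewrite counting_test_pinfty// ltxx => /(_ _)/wrap[]// k.
by rewrite mul1n.
Qed.

(** The indicator is the counting test of the sequence consisting of the given set followed by empty
    sets. *)
Lemma ML_test_indic (p : R) e : (0 < p)%R ->
  ML_test s nu p (fun y => (\1_(ce_open s e) y)%:E).
Proof.
move=> p0; pose G k : set X := [set y | k = 0%N /\ ce_open s e y].
have -> : (fun y => (\1_(ce_open s e) y)%:E) = counting_test G.
  apply/funext => y; apply/eqP; rewrite eq_le; apply/andP; split.
    rewrite indicE; case: (boolP (y \in _)) => [|_]; last exact: counting_test_ge0.
    by rewrite inE => ye; apply: (@counting_test_ge G y 0).
  apply: ge_ereal_sup => _ [->|[k [-> ye] ->]]; first by rewrite lee_fin.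
  by rewrite indicE mem_set.
have pP : (p <= (Num.bound p)%:R)%R by rewrite ltW// archi_boundP// ltW.
apply: (@ML_test_counting G 1 p (Num.bound p)) => //.
  exists [set k | nfst k == 0%N /\ ce_set e (nsnd k)].
    apply: ce_and; first by apply: ce_dec; computability.
    by apply: ce_comp; [exact: ce_ce_set|computability].
  move=> i; apply/seteqP; split=> y /=.
    by move=> [-> [k ek yk]]; exists k => //; rewrite /slice /= !npairE.
  by move=> [k]; rewrite /slice /= !npairE => -[/eqP -> ek yk]; split=> //; exists k.
move=> k; case: (posnP k) => [->|k0].
  rewrite muln0 expr0 invr1 mulr1; apply: probability_le1.
  rewrite (_ : G 0%N = ce_open s e); first exact: measurable_open_of.
  by apply/seteqP; split=> y //= -[].
rewrite (_ : G k = set0) ?measure0 ?lee_fin ?mulr_ge0 ?invr_ge0 ?exprn_ge0//.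
by apply/seteqP; split=> y //= -[k0']; rewrite k0' in k0.
Qed.

End counting_tests.

(** * Convergence in the extended reals *)

Section ereal_sequences.
Context {R : realType}.
Local Open Scope ereal_scope.

Lemma ecvg_gt (u : nat -> \bar R) (l : \bar R) :
  u n @[n --> \oo] --> l -> forall r, r < l -> \forall n \near \oo, r < u n.
Proof. by move=> ul r rl; exact: (ul _ (open_ereal_gt' rl)). Qed.

Lemma ecvg_lt (u : nat -> \bar R) (l : \bar R) :
  u n @[n --> \oo] --> l -> forall r, l < r -> \forall n \near \oo, u n < r.
Proof. by move=> ul r rl; exact: (ul _ (open_ereal_lt' rl)). Qed.

Lemma ecvg_fin (u : nat -> \bar R) (l : R) :
  (forall e : R, (0 < e)%R ->
     \forall n \near \oo, (l - e)%:E < u n /\ u n < (l + e)%:E) ->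
  u n @[n --> \oo] --> l%:E.
Proof.
move=> ul; apply/fine_cvgP; split.
  apply: filterS (ul 1%R ltr01) => n [lu ul1]; rewrite fin_real//.
  by rewrite (lt_trans _ lu) ?ltNyr// (lt_trans ul1)// ltry.
apply/cvgrPdist_lt => e e0; apply: filterS (ul e e0) => n /=.
case: (u n) => [r| |] /=; rewrite ?ltNge ?leNye ?leey ?lee_fin ?lte_fin//=.
- by rewrite -!ltNge ltr_norml => -[]; lra.
- by case.
- by case.
Qed.

End ereal_sequences.

(** * Martin-Löf random points are Kurtz random *)

Section kurtz_random.
Context {R : realType} {X : completeMetricType R}.
Variables (s : nat -> X) (nu : probability (borel X) R).

(** Same centre, radius multiplied by (L + 1)/(L + 2): as [L] grows these balls exhaust ball [k].
    The predecessors compensate for the successors in [posrat_num]. *)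
Definition shrunk_ball (k L : nat) : nat := npair (nfst k)
  (npair ((nfst (nsnd k)).+1 * L.+1).-1 ((nsnd (nsnd k)).+1 * L.+2).-1).

Lemma shrunk_ball_radius k L :
  ratr (posrat_num (nsnd (shrunk_ball k L))) =
  ratr (posrat_num (nsnd k)) * (L.+1%:R / L.+2%:R) :> R.
Proof.
rewrite /shrunk_ball npairE !posrat_numE !npairE !ratr_code !subr0.
by rewrite !prednK ?muln_gt0// !natrM invfM mulrACA.
Qed.

Lemma mem_shrunk_ball k L y : basic_ball s (shrunk_ball k L) y <->
  mdist (s (nfst k)) y < ratr (posrat_num (nsnd k)) * (L.+1%:R / L.+2%:R).
Proof.
rewrite /basic_ball shrunk_ball_radius ballEmdist /=.
by rewrite [nfst (shrunk_ball _ _)]nfst_pair.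
Qed.

Lemma ratio_succ_lt1 L : (L.+1%:R / L.+2%:R : R) < 1.
Proof. by rewrite ltr_pdivrMr ?ltr0n// mul1r ltr_nat. Qed.

Lemma ratio_succ_le L L' : (L <= L')%N ->
  (L.+1%:R / L.+2%:R : R) <= L'.+1%:R / L'.+2%:R.
Proof.
move=> LL'; rewrite ler_pdivrMr ?ltr0n// mulrAC ler_pdivlMr ?ltr0n//.
by rewrite -!natrM ler_nat; nia.
Qed.

Lemma ratr_posrat_gt0 k : 0 < (ratr (posrat_num k) : R).
Proof. by rewrite ltr0q posrat_num_gt0. Qed.

Lemma shrunk_ball_mono k L L' : (L <= L')%N ->
  basic_ball s (shrunk_ball k L) `<=` basic_ball s (shrunk_ball k L').
Proof.
move=> LL' y /mem_shrunk_ball yk; apply/mem_shrunk_ball/(lt_le_trans yk).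
by rewrite ler_wpM2l ?ratio_succ_le// ltW// ratr_posrat_gt0.
Qed.

Lemma basic_ball_shrunk k y :
  basic_ball s k y -> exists L, basic_ball s (shrunk_ball k L) y.
Proof.
rewrite /basic_ball ballEmdist /= => yk.
set d := mdist _ _ in yk; set r : R := ratr _ in yk.
have d0 : 0 <= d by exact: mdist_ge0.
(* The condition d < r (L + 1)/(L + 2) amounts to d/(r - d) < L + 1. *)
exists (Num.bound (d / (r - d))); apply/mem_shrunk_ball.
rewrite -/d -/r mulrA ltr_pdivlMr ?ltr0n//.
have rd : 0 < r - d by rewrite subr_gt0.
have := archi_boundP (divr_ge0 d0 (ltW rd)); rewrite ltr_pdivrMr//.
move: (Num.bound _) => N; rewrite -addn2 -[in r * _]addn1 !natrD; lra.
Qed.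

Hypotheses (sP : computable_polish s) (nuP : computable_measure s nu).

(* If [ce_open e] has measure 1 and misses [x], a Martin-Löf test capturing [x]
   is given by the complements of finitely many closed balls inside
   [ce_open e]: such a complement is again c.e. open, and stage [L] is used in
   the [k]-th component as soon as the shrunk open balls seen by that stage are
   known to have measure above [1 - 4^-k]. *)
Lemma MLR_KR : MLR s nu `<=` KR s nu.
Proof.
have [s_dense ds] := sP.
move=> x xM e nue; apply: contrapT => xe.
have /ce_sigma1[h dh hE] := ce_ce_set e.
(* A code [u] pairs a ball number with a witness of its enumeration. Stage [L] consists of the
   [L]-shrunk balls of the accepted codes [u < L], a finite union. *)
pose B := [set k | exists u, (u < nfst k)%N && h u &&
                             (nsnd k == shrunk_ball (nfst u) (nfst k))].
have cB : ce B.
  apply: ce_ex; apply: ce_dec; rewrite /shrunk_ball; computability.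
have [eB ceB eBE] := smn_ce_set cB.
pose UL L := ce_open s (eB L).
have ULE L y : UL L y <-> exists u, [/\ (u < L)%N, h u &
    basic_ball s (shrunk_ball (nfst u) L) y].
  rewrite /UL /ce_open eBE; split.
    move=> [k]; rewrite /slice /= => -[u]; rewrite !npairE.
    by move=> /andP[/andP[uL hu] /eqP ->] yk; exists u.
  move=> [u [uL hu yu]]; exists (shrunk_ball (nfst u) L) => //.
  by rewrite /slice /=; exists u; rewrite !npairE uL hu eqxx.
have mUL L : measurable (UL L : set (borel X)) by exact: measurable_open_of.
have UL_mono L L' : (L <= L')%N -> UL L `<=` UL L'.
  move=> LL' y /ULE[u [uL hu yu]]; apply/ULE; exists u.
  by split; [exact: leq_trans uL LL'|by []|exact: shrunk_ball_mono yu].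
have ULU : \bigcup_L UL L = ce_open s e.
  apply/seteqP; split=> y.
    move=> [L _ /ULE[u [uL hu /mem_shrunk_ball yu]]]; exists (nfst u).
      by apply/hE; exists (nsnd u); rewrite npair_fst_snd.
    rewrite /basic_ball ballEmdist /=; apply: (lt_trans yu).
    by rewrite gtr_pMr ?ratio_succ_lt1 ?ratr_posrat_gt0.
  move=> [k /hE[w hw] /basic_ball_shrunk[L yk]].
  exists (maxn L (npair k w).+1) => //; apply/ULE; exists (npair k w).
  split; [by rewrite leq_max leqnn orbT|by []|rewrite npairE].
  by apply: shrunk_ball_mono yk; rewrite leq_maxl.
pose thr k := rat_code (4 ^ k) 1 (4 ^ k).-1.
have thrE k : ratr (rat_num (thr k)) = 1 - 4 ^- k :> R.
  by rewrite ratr_code prednK ?expn_gt0// natrX mulrBl mulfV ?mul1r.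
have good k : exists L, ((ratr (rat_num (thr k)))%:E < nu (UL L))%E.
  have hcvg : nu (UL L : set (borel X)) @[L --> \oo] --> nu (ce_open s e).
    rewrite -ULU; apply: (@nondecreasing_cvg_mu _ (borel X)) => //.
      by rewrite ULU; exact: measurable_open_of.
    by move=> L L' LL'; apply/subsetPset/UL_mono.
  move: hcvg; rewrite nue thrE => /ecvg_gt hnu.
  have [|L _ hL] := hnu (1 - 4 ^- k)%:E; last by exists L; apply: hL => /=.
  by rewrite lte_fin ltrBlDr ltrDl invr_gt0 exprn_gt0.
pose rad u L := rat_code (nfst (nsnd (shrunk_ball (nfst u) L))).+1 0
                         (nsnd (nsnd (shrunk_ball (nfst u) L))).
(* The sum of the radii is below the distance of the centres: a c.e. condition which forces ball [b]
   to miss the shrunk ball of [u]. *)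
pose far L b u := [set k | ratr (rat_num (nfst k)) <
  mdist (s (nfst (nsnd k))) (s (nsnd (nsnd k))) :> R]
  (npair (rat_add (rad u L) (rat_code (nfst (nsnd b)).+1 0 (nsnd (nsnd b))))
         (npair (nfst (nfst u)) (nfst b))).
have farE L b u : far L b u <->
    ratr (posrat_num (nsnd (nfst u))) * (L.+1%:R / L.+2%:R) +
    ratr (posrat_num (nsnd b)) < mdist (s (nfst (nfst u))) (s (nfst b)) :> R.
  rewrite /far /= !npairE rat_num_add rmorphD /= -!posrat_numE.
  by rewrite shrunk_ball_radius.
pose AG := [set k | exists L, ((ratr (rat_num (thr (nfst k))))%:E < nu (UL L))%E /\
  forall u, (u < L)%N -> ~~ h u \/ far L (nsnd k) u].
have cAG : ce AG.
  apply: ce_ex; apply: ce_and.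
    have cc : computable (fun k => npair (eB (nsnd k)) (thr (nfst (nfst k)))).
      by rewrite /thr /rat_code; computability.
    by apply: eq_ce (ce_comp nuP cc) => k /=; rewrite !npairE.
  apply: (@ce_all (fun k => nsnd k)
    (fun k u => ~~ h u \/ far (nsnd k) (nsnd (nfst k)) u)); first by computability.
  apply: ce_or; first by apply: ce_dec; computability.
  apply: (ce_comp (ce_lt_computable_real ds)).
  rewrite /rad /shrunk_ball.
  apply: computable_pair; last by computability.
  apply: computable_rat_add; apply: computable_rat_code; computability.
pose G k := open_of s (slice AG k).
have Gx k : G k x.
  have [L hL] := good k.
  (* Since [x] lies outside the unshrunk balls, its distance to each centre exceeds the shrunk
     radius. Only finitely many balls occur at stage [L], so a common margin [d] exists. *)
  have [d d0 hd] : exists2 d : R, 0 < d & forall u, (u < L)%N -> h u ->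
     ratr (posrat_num (nsnd (nfst u))) * (L.+1%:R / L.+2%:R) + d <=
     mdist (s (nfst (nfst u))) x.
    have H u : h u -> ratr (posrat_num (nsnd (nfst u))) * (L.+1%:R / L.+2%:R) <
        mdist (s (nfst (nfst u))) x.
      move=> hu; rewrite ltNge; apply/negP => hx; apply: xe; exists (nfst u).
        by apply/hE; exists (nsnd u); rewrite npair_fst_snd.
      rewrite /basic_ball ballEmdist /=; apply: (le_lt_trans hx).
      by rewrite gtr_pMr ?ratio_succ_lt1 ?ratr_posrat_gt0.
    elim: {1}L => [|n [d d0 hd]]; first by exists 1.
    case: (boolP (h n)) => hn; last first.
      exists d => // u; rewrite ltnS leq_eqVlt => /orP[/eqP ->|]; last exact: hd.
      by rewrite (negPf hn).
    exists (Num.min d (mdist (s (nfst (nfst n))) x -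
       ratr (posrat_num (nsnd (nfst n))) * (L.+1%:R / L.+2%:R))).
      by rewrite lt_min d0 subr_gt0 H.
    move=> u; rewrite ltnS leq_eqVlt => /orP[/eqP -> _|un hu].
      by rewrite -lerBrDl ge_min lexx orbT.
    apply: le_trans (hd u un hu); rewrite lerD2l.
    by rewrite ge_min lexx.
  (* Half of the margin pays for the distance from [x] to the centre of [b], the other half for the
     radius of [b]. *)
  have d20 : 0 < d / 2 by rewrite divr_gt0.
  have [b xb [bd tb]] := basic_ball_near x s_dense d20.
  exists b => //; rewrite /slice /AG /=; exists L; rewrite !npairE; split=> // u uL.
  case: (boolP (h u)) => hu; [right|by left].
  apply/farE; move: (hd u uL hu); set r := (_ * _ : R) => rd.
  have tri : mdist (s (nfst (nfst u))) x <=
      mdist (s (nfst (nfst u))) (s (nfst b)) + mdist (s (nfst b)) x :> R.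
    exact: metric_triangle.
  lra.
have nuG k : (nu (G k : set (borel X)) <= (1 * 4 ^- k)%:E)%E.
  (* Different balls of [G k] may stem from different stages. Each of these stages contains the
     least good one, so all of [G k] misses [UL L0]. *)
  have [L0 /asboolP hL0 L0min] := @ex_minnP (fun L =>
     `[< ((ratr (rat_num (thr k)))%:E < nu (UL L))%E >])
     (let: ex_intro L hL := good k in ex_intro _ L (asboolT hL)).
  have GL0 : G k `<=` ~` UL L0.
    move=> y [b]; rewrite /slice /AG /= !npairE => -[L [hL farL]] yb.
    move=> /(UL_mono _ _ (L0min L (asboolT hL)))/ULE[u [uL hu /mem_shrunk_ball yu]].
    case: (farL u uL) => [|/farE]; first by rewrite hu.
    move: yb; rewrite /basic_ball ballEmdist /= => yb.
    have : mdist (s (nfst (nfst u))) (s (nfst b)) <=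
        mdist (s (nfst (nfst u))) y + mdist (s (nfst b)) y :> R.
      by rewrite (metric_sym (s (nfst b)) y); exact: metric_triangle.
    move: yu; set r := (_ * _ : R); lra.
  apply: (@le_trans _ _ (nu (~` (UL L0 : set (borel X))))).
    apply: le_measure => //; rewrite inE; first exact: measurable_open_of.
    exact: measurableC.
  rewrite mul1r probability_setC//.
  move: hL0; rewrite thrE -(fineK (fin_num_measure nu _ (mUL L0))).
  by rewrite -EFinB !lte_fin lee_fin; lra.
have uG : unif_ce_open s G by exists AG.
have [k] := MLR_not_in_all s_dense uG nuG xM.
by apply.
Qed.

End kurtz_random.

(** * Doob's maximal inequality *)

Section maximal_inequality.
Context {R : realType} {X : completeMetricType R}.
Variables (nu : probability (borel X) R) (F : nat -> set (set X)).
Variable rho : nat -> R.-ftker (borel X) ~> (borel X).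
Variable A : nat -> nat -> set X.
Hypothesis FS : forall n, F n `<=` F n.+1.
Hypothesis FA : forall n, F n = <<s range (A n) >>.
Hypothesis rhoF : forall n f, nu.-integrable [set: borel X] f ->
  cond_exp_version nu (F n) f (cond_exp (rho n) f).

Lemma cond_exp_indic (k : R.-ftker (borel X) ~> (borel X)) U x :
  measurable (U : set (borel X)) ->
  cond_exp k (fun y => (\1_U y)%:E) x = k x U.
Proof. by move=> mU; rewrite /cond_exp integral_indic// setIT. Qed.

Lemma filtration_mono m n : (m <= n)%N -> F m `<=` F n.
Proof.
move=> /subnK <-; elim: (n - m)%N => [//|k IH].
exact: subset_trans IH (@FS _).
Qed.

Local Open Scope ereal_scope.

(* Doob's maximal inequality, splitting the event according to the first
   index at which the threshold is exceeded. *)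
Lemma doob_maximal_inequality (V : set X) (lam : R) :
  measurable (V : set (borel X)) -> (0 < lam)%R ->
  lam%:E * nu (\bigcup_n [set y : borel X | lam%:E < rho n y V]) <=
  nu (V : set (borel X)).
Proof.
move=> mV lam0.
have mrho n : measurable_fun setT (fun y : borel X => rho n y V).
  exact: measurable_kernel.
pose E n : set (borel X) := [set y | lam%:E < rho n y V].
have mE n : measurable (E n).
  by rewrite -[E n]setTI; exact: emeasurable_fun_o_infty.
have iV : nu.-integrable [set: borel X] (fun y => (\1_V y)%:E).
  exact: integrable_indic.
have FE n : F n (E n).
  have [+ _ _] := rhoF n iV.
  move=> /(emeasurable_fun_o_infty measurableT)/(_ lam%:E); rewrite setTI.
  (* The measurable sets of the target type are those generated by [F n], which is already a
     sigma-algebra. *)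
  rewrite /measurable /= sigma_algebra_id; last first.
    by rewrite FA; exact: smallest_sigma_algebra.
  congr (F n _); apply/seteqP; split=> y /=; rewrite cond_exp_indic//.
pose D := seqDU E.
have FD n : F n (D n).
  rewrite /D /seqDU FA.
  change (measurable (E n `\` \big[setU/set0]_(m < n) E m
    : set (g_sigma_algebraType (range (A n))))).
  apply: measurableD.
    by have := FE n; rewrite FA.
  apply: bigsetU_measurable => m _.
  by have := filtration_mono (ltnW (ltn_ord m)) (FE m); rewrite FA.
have mD n : measurable (D n : set (borel X)).
  by apply: measurableD => //; exact: bigsetU_measurable.
(* On [D n] the conditional expectation of the indicator of [V] exceeds [lam], and [D n] belongs to
   [F n], so it integrates there to the measure of [V] within [D n]. *)
have DV n : lam%:E * nu (D n) <= nu (V `&` D n).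
  have [_ _ /(_ _ (FD n))] := rhoF n iV.
  rewrite integral_indic// => <-.
  rewrite -integral_cst//; apply: ge0_le_integral => //.
  - by move=> y _; rewrite lee_fin ltW.
  - apply: eq_measurable_fun (measurable_funTS (mrho n)) => y _.
    by rewrite cond_exp_indic.
  - move=> y [Ey _]; rewrite cond_exp_indic//; exact: ltW.
rewrite -/E seqDU_bigcup_eq -/D.
have tD : trivIset setT D by exact: trivIset_seqDU.
rewrite measure_semi_bigcup//; last exact: bigcupT_measurable.
rewrite -nneseriesZl//.
apply: (@le_trans _ _ (\sum_(0 <= n <oo) nu (V `&` D n))).
  apply: lee_nneseries => [n _ _|n _]; last exact: DV.
  by rewrite mule_ge0// lee_fin ltW.
have mVD n : measurable (V `&` D n : set (borel X)) by exact: measurableI.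
rewrite -measure_semi_bigcup//.
- apply: le_measure; rewrite ?inE//; first exact: bigcupT_measurable.
  by move=> y [n _ []].
- exact: trivIset_setIl.
- exact: bigcupT_measurable.
Qed.

End maximal_inequality.

(** * Superlevel sets of tests and their measures *)

Section randomness_lemmas.
Context {R : realType} {X : completeMetricType R}.
Variables (s : nat -> X) (nu : probability (borel X) R).

(** Markov's inequality for the p-th power at threshold 2^(b i), whose p-th power is at least 2^(c
    i). The constant is the integral of |f|^p. *)
Lemma ML_test_tail (f : X -> \bar R) (p : R) (b c : nat) :
  0 < p -> c%:R <= b%:R * p -> ML_test s nu p f ->
  exists2 C : R, 0 <= C & forall i,
    (nu ([set y | (2 ^+ (b * i))%:E < f y] : set (borel X)) <=
     (C * 2 ^- (c * i))%:E)%E.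
Proof.
move=> p0 cbp [lf f0 nf].
have mf := measurable_lower_semicomputable lf.
have K0 : (0 <= \int[nu]_y (`|f y| `^ p))%E.
  by apply: integral_ge0 => y _; exact: poweR_ge0.
have Kfin : (\int[nu]_y (`|f y| `^ p))%E \is a fin_num.
  rewrite ge0_fin_numE//.
  rewrite -(@poweR_Lnorm _ _ _ nu f) ?gt_eqF//; exact: poweR_lty.
exists (fine (\int[nu]_y (`|f y| `^ p))%E); first exact: fine_ge0.
move=> i; set a : R := 2 ^+ (b * i).
have a0 : 0 < a by rewrite exprn_gt0.
have := @le_integral_comp_abse _ _ _ nu setT measurableT f a (fun x => (x `^ p)%E)
  (measurable_poweR p) (fun r _ => poweR_ge0 r p) _ mf a0.
move=> /(_ _)/wrap[].
  move=> u v; rewrite !inE /= !in_itv /= !andbT => u0 v0 uv.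
  by apply: gt0_ler_poweR => //; rewrite ?ltW// in_itv /= ?u0 ?v0 leey.
rewrite setTI => markov; rewrite -(fineK Kfin) in markov.
have ac : 2 ^+ (c * i) <= a `^ p.
  rewrite /a -!powR_mulrn// -powRrM ler_powR ?ler1n// !natrM -mulrA.
  by rewrite [i%:R * p]mulrC mulrA ler_wpM2r.
set S := [set y | _]; have mS : measurable (S : set (borel X)).
  by rewrite -[S]setTI; exact: emeasurable_fun_o_infty.
have mS' : measurable [set y : borel X | (a%:E <= `|f y|)%E].
  rewrite -[X in measurable X]setTI.
  by apply: emeasurable_fun_c_infty => //; exact: measurableT_comp.
have SS' : S `<=` [set y | (a%:E <= `|f y|)%E].
  by move=> y /= /ltW; rewrite gee0_abs.
have nuS : (nu (S : set (borel X)) <= nu [set y : borel X | (a%:E <= `|f y|)%E])%E.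
  by apply: le_measure; rewrite ?inE.
have : ((2 ^+ (c * i))%:E * nu (S : set (borel X)) <=
    (fine (\int[nu]_y (`|f y| `^ p))%E)%:E)%E.
  by apply: le_trans markov; rewrite poweR_EFin; exact: lee_pmul.
rewrite -(fineK (fin_num_measure nu _ mS)) -EFinM !lee_fin => h.
by rewrite ler_pdivlMr ?exprn_gt0// mulrC.
Qed.

Lemma ce_open_gt_pow2 f (b : nat) : lower_semicomputable s f ->
  unif_ce_open s (fun i => [set y | (2 ^+ (b * i))%:E < f y]%E).
Proof.
move=> [_ [A cA fA]].
exists [set k | A (npair (rat_code (2 ^ (b * nfst k)) 0 0) (nsnd k))].
  by apply: ce_comp => //; rewrite /rat_code; computability.
move=> i; have := fA (rat_code (2 ^ (b * i)) 0 0).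
rewrite ratr_code subr0 divr1 natrX => ->.
by congr open_of; apply/seteqP; split=> k; rewrite /slice /= !npairE.
Qed.

End randomness_lemmas.

(** * Density random points *)

Section density_random.
Context {R : realType} {X : completeMetricType R}.
Variables (s : nat -> X) (nu : probability (borel X) R) (F : nat -> set (set X)).
Variable rho : nat -> R.-ftker (borel X) ~> (borel X).
Hypothesis sP : computable_polish s.

(** Randomness concerns L_1 tests, convergence L_p tests. If an L_1 test [f] is infinite at [x], the
    sets {f > 4^(P k)} have measure O(4^-(P k)), so their counting test is an L_p test, and it too
    is infinite at [x]. *)
Lemma MLR_of_cvg (p : R) x : 0 < p ->
  (forall f, ML_test s nu p f ->
     exists l : R, cond_exp (rho n) f x @[n --> \oo] --> l%:E) ->
  (forall e, rho n x (ce_open s e) @[n --> \oo] -->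
     ((\1_(ce_open s e) x)%:E : \bar R)) ->
  MLR s nu x.
Proof.
move=> p0 xf xU f f1; have [s_dense _] := sP.
rewrite ltey; apply/eqP => fx.
have [lf f0 _] := f1.
pose P := Num.bound p.
have pP : p <= P%:R by rewrite ltW// archi_boundP// ltW.
have [|C C0 tailf] := @ML_test_tail _ _ s nu f 1 (2 * P) (2 * P) ltr01 _ f1.
  by rewrite mulr1.
have uG := ce_open_gt_pow2 (2 * P) lf.
set G := (fun i => _) in uG.
have tG : ML_test s nu p (counting_test G).
  apply: (ML_test_counting s_dense uG p0 pP) => k.
  apply: le_trans (tailf k) _.
  by rewrite -mulnA exprM (_ : 2 ^+ 2 = 4)// expr2 -natrM.
have Tx : counting_test G x = +oo%E.
  by apply: counting_test_pinfty => k; rewrite /G /= fx ltry.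
have [l Tl] := xf _ tG.
have [lT T0 _] := tG.
have [e _ eE] := lower_semicomputable_gt lT.
(* Eventually the set where the counting test exceeds [m] has mass above 1/2, so the conditional
   expectation is at least m/2 > |l| + 1, against convergence to [l]. *)
pose m := Num.bound (2 * (`|l| + 1)).
have lm : 2 * (`|l| + 1) < m%:R by rewrite archi_boundP// mulr_ge0// addr_ge0.
pose q := rat_code m 0 0.
have qE : ratr (rat_num q) = m%:R :> R by rewrite ratr_code subr0 divr1.
have := xU (e q); rewrite -eE qE indicE mem_set /=; last by rewrite Tx ltry.
move=> /ecvg_gt/(_ (2^-1)%:E _)/wrap[]; first by rewrite lte_fin; lra.
move=> h1; have /(_ (`|l| + 1)%:E _)/wrap[] := ecvg_lt Tl.
  by rewrite lte_fin; have := ler_norm l; lra.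
move=> h2; have [N _ /(_ N (leqnn N))[/= r1 r2]] := filterI h1 h2.
have mT := measurable_lower_semicomputable lT.
have := @le_measure_gt_integral _ _ _ (rho N x) _
   [set y | (m%:R%:E < counting_test G y)%E] m%:R T0 mT _ (ler0n _ _).
move=> /(_ _)/wrap[]; first by rewrite -qE eE; exact: measurable_open_of.
move=> /(_ (fun y => @ltW _ _ _ _))/le_lt_trans/(_ r2).
apply/negP; rewrite -leNgt.
apply: (@le_trans _ _ (m%:R%:E * (2^-1)%:E)%E).
  by rewrite -EFinM lee_fin; lra.
by apply: lee_wpmul2l; [rewrite lee_fin|exact: ltW].
Qed.

Hypothesis nuP : computable_measure s nu.
Hypothesis FP : almost_full_filtration s nu F.
Hypothesis rhoP : kurtz_disintegrations s nu F rho.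

(** Dividing the tail 2^-((b+2) i) by the threshold 4^k 2^-((b+1) i) in Doob's inequality leaves
    4^-k 2^-i, which is summable over [i]. A random point then escapes some component of the
    resulting test. *)
Lemma DR_maximal_bound (f : X -> \bar R) (p : R) (b : nat) x :
  0 < p -> (b + 2)%:R <= b%:R * p -> ML_test s nu p f -> MLR s nu x ->
  exists k, forall n i,
    (rho n x [set y | (2 ^+ (b * i))%:E < f y] <=
     (4 ^+ k / 2 ^+ ((b + 1) * i))%:E)%E.
Proof.
move=> p0 bp fp xM; have [s_dense _] := sP; have [lf f0 _] := fp.
have [FS [A [FA _ _]]] := FP.
have [rhoF _ [_ [B cB BE]]] := rhoP.
have [C C0 tailf] := ML_test_tail p0 bp fp.
have [eV ceV eVE] := unif_ce_openP (ce_open_gt_pow2 b lf).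
pose lamc k i := rat_code (4 ^ k) 0 (2 ^ ((b + 1) * i)).-1.
have lamE k i : ratr (rat_num (lamc k i)) = 4 ^+ k / 2 ^+ ((b + 1) * i) :> R.
  by rewrite ratr_code subr0 prednK ?expn_gt0// !natrX.
pose E k n i := [set y | (ratr (rat_num (lamc k i)))%:E < rho n y (ce_open s (eV i))]%E.
pose AG := [set z | exists n, exists i,
  B (npair (npair (npair n (eV i)) (lamc (nfst z) i)) (nsnd z))].
pose G k := open_of s (slice AG k).
have GE k : G k = \bigcup_i \bigcup_n E k n i.
  apply/seteqP; split=> y.
    move=> [z]; rewrite /slice /AG /= !npairE => -[n [i Bz]] yz.
    exists i => //; exists n => //.
    have := BE (npair (npair n (eV i)) (lamc k i)); rewrite !npairE /E => ->.
    by exists z.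
  move=> [i _ [n _]].
  have := BE (npair (npair n (eV i)) (lamc k i)); rewrite !npairE /E => ->.
  move=> [z Bz yz]; exists z => //; rewrite /slice /AG /= !npairE.
  by exists n, i.
have uG : unif_ce_open s G.
  exists AG => //; do 2!apply: ce_ex; apply: ce_comp => //.
  by rewrite /lamc /rat_code; computability.
have mE k i : measurable (\bigcup_n E k n i : set (borel X)).
  apply: bigcupT_measurable => n; have := BE (npair (npair n (eV i)) (lamc k i)).
  by rewrite !npairE /E => ->; exact: measurable_open_of.
have nuG k : (nu (G k : set (borel X)) <= ((2 * C) * 4 ^- k)%:E)%E.
  apply: le_trans (measure_sigma_subadditive nu (mE k) _ _) _.
  - exact: measurable_open_of.
  - by rewrite GE.
  apply: le_trans (@epsilon_trick0 _ _ xpredT _); last first.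
    by rewrite !mulr_ge0// invr_ge0 exprn_ge0.
  apply: lee_nneseries => // i _.
  have lam0 : 0 < 4 ^+ k / 2 ^+ ((b + 1) * i) :> R.
    by rewrite divr_gt0 ?exprn_gt0.
  apply: (@le_trans _ _ (nu (\bigcup_n E k n i : set (borel X)))) => //.
  have : ((4 ^+ k / 2 ^+ ((b + 1) * i))%:E * nu (\bigcup_n E k n i : set (borel X))
      <= (C * 2 ^- ((b + 2) * i))%:E)%E.
    apply: le_trans (tailf i); rewrite (eVE i) /E lamE.
    by apply: (doob_maximal_inequality FS FA rhoF) => //; exact: measurable_open_of.
  rewrite -(fineK (fin_num_measure nu _ (mE k i))) -EFinM !lee_fin.
  move: (fine _) => u.
  rewrite (_ : (b + 2) * i = (b + 1) * i + i)%N; last by lia.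
  rewrite exprD natrX exprS.
  have : 0 < 4 ^+ k :> R by rewrite exprn_gt0.
  have : 0 < 2 ^+ i :> R by rewrite exprn_gt0.
  have : 0 < 2 ^+ ((b + 1) * i) :> R by rewrite exprn_gt0.
  move: (4 ^+ k : R) (2 ^+ i : R) (2 ^+ ((b + 1) * i) : R) => z y c c0 y0 z0 h.
  (* Both sides are written as multiples of c/z, the reciprocal of Doob's threshold. *)
  have -> : u = c / z * (z / c * u) by field; rewrite !gt_eqF.
  have -> : 2 * C / z / (2 * y) = c / z * (C / (c * y)).
    by field; rewrite !gt_eqF.
  by rewrite ler_wpM2l// divr_ge0// ltW.
have [k xk] := MLR_not_in_all s_dense uG nuG xM.
exists k => n i; rewrite (eVE i) leNgt -lamE; apply/negP => h; apply: xk.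
by rewrite GE; exists i => //; exists n.
Qed.

(** From below, Markov's inequality at levels under [f x]. From above, [f] is cut at a level [q]
    just above [f x] and at 2^(b J): the middle part vanishes in the limit because [x] is not in {f
    > q}, and the tail is small uniformly in [n] by [DR_maximal_bound]. *)
Lemma DR_cond_exp_cvg (f : X -> \bar R) (p : R) x : 1 < p ->
  ML_test s nu p f -> DR s nu rho x ->
  f x \is a fin_num /\ cond_exp (rho n) f x @[n --> \oo] --> f x.
Proof.
move=> p1 fp [xM xU]; have [lf f0 _] := fp.
have p0 : 0 < p by lra.
have mf := measurable_lower_semicomputable lf.
have xK : KR s nu x by exact: MLR_KR xM.
have rhoT n : rho n x setT = 1%E by have [_ /(_ n x xK)[]] := rhoP.
(* The requirement b + 2 <= b p says b (p - 1) >= 2, hence p > 1. *)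
pose b := Num.bound (2 / (p - 1)).
have bp : (b + 2)%:R <= b%:R * p.
  have : 2 / (p - 1) < b%:R by rewrite archi_boundP// divr_ge0// subr_ge0 ltW.
  by rewrite ltr_pdivrMr ?subr_gt0// natrD; lra.
have [k rhok] := DR_maximal_bound p0 bp fp xM.
have [eV _ eVE] := unif_ce_openP (ce_open_gt_pow2 b lf).
have [eq _ eqE] := lower_semicomputable_gt lf.
have b0 : (0 < b)%N.
  by rewrite lt0n; apply/eqP => b0; move: bp; rewrite b0 mul0r add0n lern0.
pose V i := [set y | (2 ^+ (b * i))%:E < f y]%E.
have mV i : measurable (V i : set (borel X)).
  by rewrite /V (eVE i); exact: measurable_open_of.
have cvg1 e : ce_open s e x -> rho n x (ce_open s e) @[n --> \oo] --> 1%E.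
  by move=> xe; have := xU e; rewrite diracE mem_set.
have cvg0 e : ~ ce_open s e x -> rho n x (ce_open s e) @[n --> \oo] --> 0%E.
  by move=> xe; have := xU e; rewrite diracE memNset.
have fxfin : f x \is a fin_num.
  rewrite ge0_fin_numE// ltey; apply/eqP => fx.
  (* With this [i] the bound 4^k / 2^((b+1) i) is at most 1/2, whereas an infinite value at [x]
     would make the mass of [V i] tend to 1. *)
  pose i := (2 * k).+1.
  have xi : ce_open s (eV i) x by rewrite -eVE /= fx ltry.
  have /ecvg_gt/(_ (2^-1)%:E _)/wrap[] := cvg1 _ xi.
    by rewrite lte_fin; lra.
  move=> [N _ /(_ N (leqnn N))] /=; apply/negP; rewrite -leNgt.
  rewrite -eVE; apply: le_trans (rhok N i) _; rewrite lee_fin.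
  rewrite (_ : 4 = 2 ^+ 2 :> R); last by rewrite expr2 -natrM.
  rewrite -exprM ler_pdivrMr ?exprn_gt0// mulrC ler_pdivlMr//.
  rewrite -exprSr ler_eXn2l ?ltr1n// mulnDl mul1n.
  exact: leq_addl.
split=> //.
pose l := fine (f x); have fxl : f x = l%:E by rewrite fineK.
have l0 : 0 <= l by rewrite fine_ge0.
rewrite fxl.
have Ege n q : 0 <= ratr (rat_num q) :> R ->
    ((ratr (rat_num q))%:E * rho n x (ce_open s (eq q)) <= cond_exp (rho n) f x)%E.
  move=> q0; apply: le_measure_gt_integral => //; first exact: measurable_open_of.
  by move=> y; rewrite -eqE => /ltW.
apply: ecvg_fin => e e0.
have lower : \forall n \near \oo, ((l - e)%:E < cond_exp (rho n) f x)%E.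
  case: (ltP (l - e) 0) => le0.
    apply: nearW => n; apply: (@lt_le_trans _ _ 0%E); first by rewrite lte_fin.
    by apply: integral_ge0 => y _; exact: f0.
  have [|q leq ql] := @rat_num_between R (l - e) l; first by lra.
  have q0 : 0 < ratr (rat_num q) :> R by exact: le_lt_trans leq.
  have xq : ce_open s (eq q) x by rewrite -eqE /= fxl lte_fin.
  have /ecvg_gt/(_ ((l - e) / ratr (rat_num q))%:E _)/wrap[] := cvg1 _ xq.
    by rewrite lte_fin ltr_pdivrMr// mul1r.
  apply: filterS => n hn; apply: lt_le_trans (Ege n q (ltW q0)).
  rewrite -lte_pdivrMl//.
  by rewrite -EFinM mulrC.
have upper : \forall n \near \oo, (cond_exp (rho n) f x < (l + e)%:E)%E.
  have [|q lq qle] := @rat_num_between R l (l + e / 2); first by lra.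
  have q0 : 0 < ratr (rat_num q) :> R by exact: le_lt_trans lq.
  have c0 : 0 < 2 ^+ b * 4 ^+ k :> R by rewrite mulr_gt0// exprn_gt0.
  (* The tail will sum to at most 2 * 2^-J * 2^b * 4^k, which this choice puts below e/4. *)
  have [|J hJ] := @exists_expVn_lt R (e / 8 / (2 ^+ b * 4 ^+ k)).
    by rewrite !divr_gt0.
  rewrite ltr_pdivlMr// in hJ.
  have a0 : 0 < 2 ^+ (b * J) :> R by rewrite exprn_gt0.
  have xq : ~ ce_open s (eq q) x.
    by rewrite -eqE /= fxl lte_fin; apply/negP; rewrite -leNgt ltW.
  have /ecvg_lt/(_ (e / 4 / 2 ^+ (b * J))%:E _)/wrap[] := cvg0 _ xq.
    by rewrite lte_fin !divr_gt0.
  apply: filterS => n hn.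
  (* [w i] is the threshold of the next layer [V (J + i).+1], hence bounds [f] on the part of
     [V (J + i)] outside it. *)
  pose w i : R := 2 ^+ (b * (J + i).+1).
  have w0 i : 0 <= w i by rewrite exprn_ge0.
  have := @integral_indic_series_le _ _ _ (rho n x) f (ratr (rat_num q))
    (2 ^+ (b * J)) w (ce_open s (eq q)) (fun i => V (J + i)%N) f0 mf
    (measurable_open_of _ _) (fun i => mV _) (ltW q0) (ltW a0) w0.
  move=> /(_ _)/wrap[].
    move=> y; set S := \big[_/_]_(_ <= _ <oo) _.
    have t0 i : (0 <= (w i * \1_(V (J + i)%N) y)%:E)%E by rewrite lee_fin mulr_ge0.
    have S0 : (0 <= S)%E by apply: nneseries_ge0 => i _ _; exact: t0.
    have [fq|qf] := leP (f y) (ratr (rat_num q))%:E.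
      by apply: le_trans fq _; rewrite -addeA leeDl// adde_ge0// lee_fin mulr_ge0// ltW.
    have yU : ce_open s (eq q) y by rewrite -eqE.
    rewrite indicE mem_set// mulr1.
    have [fa|af] := leP (f y) (2 ^+ (b * J))%:E.
      apply: le_trans fa _; rewrite [X in (X + _)%E]addeC -addeA leeDl//.
      by rewrite adde_ge0// lee_fin ltW.
    suff : (f y <= S)%E.
      by move=> /le_trans; apply; rewrite leeDr// adde_ge0// lee_fin ltW.
    have term i : V (J + i)%N y -> ((w i)%:E <= S)%E.
      move=> yV; apply: le_trans (nneseries_ge_term i t0).
      by rewrite indicE mem_set// mulr1.
    have w_unbounded r : exists i, r <= w i.
      exists (Num.bound `|r|); apply: (le_trans (ler_norm r)).
      apply: le_trans (ltW (archi_boundP (normr_ge0 r))) _.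
      rewrite /w -natrX ler_nat; apply: leq_trans (ltnW (ltn_expl _ (ltnSn 1))) _.
      rewrite leq_exp2l//; apply: leq_trans (leq_pmull _ b0).
      exact: leqW (leq_addl _ _).
    case fy : (f y) => [r| |]; last by rewrite leNye.
      (* The least [i] with [f y <= w i] puts [y] in [V (J + i)]: for i = 0 by [af], otherwise
         because the preceding weight is exceeded. *)
      have [i ri imin] := ex_minnP (w_unbounded r).
      apply: (@le_trans _ _ (w i)%:E); first by rewrite lee_fin.
      apply: term; case: i ri imin => [|i] ri imin; first by rewrite addn0.
      rewrite /V /= fy lte_fin addnS ltNge; apply/negP => /imin.
      by rewrite ltnn.
    rewrite leye_eq; apply/eqP/eqyP => r r0; have [i ri] := w_unbounded r.
    apply: (@le_trans _ _ (w i)%:E); first by rewrite lee_fin.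
    by apply: term; rewrite /V /= fy ltry.
  move=> /le_lt_trans; apply.
  rewrite rhoT mule1.
  have tail : (\sum_(0 <= i <oo) ((w i)%:E * rho n x (V (J + i)%N)) <= (e / 4)%:E)%E.
    apply: (@le_trans _ _ (2 * (2 ^- J * (2 ^+ b * 4 ^+ k)))%:E); last first.
      by rewrite lee_fin; lra.
    apply: le_trans (@epsilon_trick0 _ _ xpredT _); last first.
      by rewrite !mulr_ge0 ?invr_ge0 ?exprn_ge0.
    apply: lee_nneseries => [i _ _|i _]; first by rewrite mule_ge0// lee_fin.
    apply: le_trans (lee_wpmul2l _ (rhok n (J + i)%N)) _; first by rewrite lee_fin.
    rewrite -EFinM lee_fin /w le_eqVlt; apply/orP; left; apply/eqP.
    (* The weight 2^(b (J+i+1)) cancels the bound 4^k 2^-((b+1)(J+i)) down to 4^k 2^b 2^-(J+i). *)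
    rewrite mulnS mulnDl mul1n !exprD natrX exprS.
    by field; rewrite !expf_neq0 ?pnatr_eq0.
  apply: (@le_lt_trans _ _ (ratr (rat_num q) + e / 4 + e / 4)%:E).
    rewrite !EFinD; apply: leeD => //; apply: leeD => //.
    rewrite [leRHS](_ : _ = ((2 ^+ (b * J))%:E * (e / 4 / 2 ^+ (b * J))%:E)%E).
      by apply: lee_wpmul2l; [rewrite lee_fin ltW|exact: ltW].
    by rewrite -EFinM mulrCA mulfV ?mulr1 ?gt_eqF.
  by rewrite lte_fin; lra.
by by by by by apply: filterS (filterI lower upper) => n [].
Qed.

End density_random.

(** * Equivalence of the three conditions, proved as a cycle *)

Theorem theorem1p8 (R : realType) (X : completeMetricType R) (s : nat -> X)
    (nu : probability (borel X) R) (F : nat -> set (set X))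
    (rho : nat -> R.-ftker (borel X) ~> (borel X)) (p : R) :
  computable_polish s ->
  computable_measure s nu ->
  almost_full_filtration s nu F ->
  kurtz_disintegrations s nu F rho ->
  1 < p -> computable_real p ->
  forall x : X,
  [<-> DR s nu rho x;
       KR s nu x /\
       forall f, ML_test s nu p f ->
         f x \is a fin_num /\ cond_exp (rho n) f x @[n --> \oo] --> f x;
       [/\ KR s nu x,
           forall f, ML_test s nu p f ->
             exists l : R, cond_exp (rho n) f x @[n --> \oo] --> l%:E &
           forall e,
             cond_exp (rho n) (fun y => (\1_(ce_open s e) y)%:E) x @[n --> \oo]
               --> ((\1_(ce_open s e) x)%:E : \bar R)]].
Proof.
move=> sP nuP FP rhoP p1 _ x; have [s_dense _] := sP.
have p0 : 0 < p by exact: lt_trans p1.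
tfae.
- move=> xD; have [xM _] := xD; split; first exact: MLR_KR xM.
  by move=> f fp; exact: (DR_cond_exp_cvg sP nuP FP rhoP p1 fp xD).
- move=> [xK xf]; split=> // [f /xf[ffin fcvg]|e].
    by exists (fine (f x)); rewrite fineK.
  (* Convergence on c.e. open sets is the instance of (2) for indicators, which are L_p tests. *)
  by have [_ ?] := xf _ (ML_test_indic nu s_dense e p0).
- move=> [_ xf xU].
  have xU' e : rho n x (ce_open s e) @[n --> \oo] --> ((\1_(ce_open s e) x)%:E : \bar R).
    rewrite (_ : (fun n => _) =
        (fun n => cond_exp (rho n) (fun y => (\1_(ce_open s e) y)%:E) x)) //.
    by apply/funext => n; rewrite cond_exp_indic//; exact: measurable_open_of.
  split; first exact: (MLR_of_cvg sP p0 xf xU').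
  by move=> e; rewrite diracE; have := xU' e; rewrite indicE.
Qed.
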